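(* Let $N\ge1$, $h,l>0$, $\theta\in\mathbb R^3$ with $\theta_1\theta_2\theta_3\ne0$, and let $T=T_N:(0,\infty)\to[0,1]$ be the transmission probability of the $N$-resonator system described in the context, with vertex conditions of type I or of type II at the vertices $v_j$ and with either Neumann conditions ($\alpha=0$) or Dirichlet conditions ($\beta=0$) at the pendant vertices $u_j$. Then $T$ is (i) periodic in $k$ if $l/h\in\mathbb Q$; (ii) two-frequency quasi-periodic in $k$ if $l/h\notin\mathbb Q$.
   Context: Model. The metric graph $G$ has vertices $v_1,\dots,v_N$ of degree 3, placed on the real line (the channel) at $x_j=(j-1)h$, and vertices $u_1,\dots,u_N$ of degree 1. The channel consists of the leads $e_{in}=(-\infty,0]$ (ending at $v_1$), $e_{out}=[(N-1)h,+\infty)$ (starting at $v_N$), and the segments of length $h$ between consecutive $v_j$'s. At each $v_j$ a resonator edge $(v_j,u_j)$ of length $l$ is attached, with coordinate $s\in[0,l]$, $s=0$ at $v_j$ and $s=l$ at $u_j$. At $v=v_j$, $\psi_1(v),\psi_2(v),\psi_3(v)$ denote the limits of $\psi$ at $v$ along the left channel edge, the right channel edge and the resonator edge, and $\psi_i'(v)$ the corresponding one-sided derivatives taken in the direction from $v$ into the edge. Vertex conditions at every $v_j$. Type I: $\frac{\psi_1(v)}{\theta_1}=\frac{\psi_2(v)}{\theta_2}=\frac{\psi_3(v)}{\theta_3}$ and $\theta_1\psi_1'(v)+\theta_2\psi_2'(v)+\theta_3\psi_3'(v)=0$. Type II: $\frac{\psi_1'(v)}{\theta_1}=\frac{\psi_2'(v)}{\theta_2}=\frac{\psi_3'(v)}{\theta_3}$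 and $\theta_1\psi_1(v)+\theta_2\psi_2(v)+\theta_3\psi_3(v)=0$. Endpoint condition at each $u_j$: $\alpha\psi+\beta\frac{d\psi}{ds}=0$ at $s=l$, $(\alpha,\beta)\neq(0,0)$; so Neumann means $\frac{d\psi}{ds}=0$ and Dirichlet means $\psi=0$ at $s=l$. Scattering solution at wavenumber $k>0$: a function $\psi$ on $G$ with $\psi''+k^2\psi=0$ on every edge, satisfying all vertex and endpoint conditions, with $\psi(x)=e^{ikx}+r_N(k)e^{-ikx}$ on $e_{in}$ and $\psi(x)=t_N(k)e^{ikx}$ on $e_{out}$. The amplitudes are uniquely determined; $T_N(k)=|t_N(k)|^2$. Terminology. Periodic: there is $P>0$ with $T(k+P)=T(k)$ for all $k>0$. Two-frequency quasi-periodic (with the rationally independent frequencies given by $l$ and $h$): there are a closed discrete set $D\subset\mathbb R^2$ and a continuous function $F:\mathbb R^2\setminus D\to\mathbb R$, $\pi$-periodic in each of its two arguments, such that $(kl,kh)\notin D$ and $T(k)=F(kl,kh)$ for all $k>0$. *)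

(* Defs.v *)
From Stdlib Require Import Reals QArith Qreals ClassicalEpsilon.
From Coquelicot Require Import Coquelicot.
Open Scope R_scope.

(** [edge_data g c d]: the function [g] on an edge, parametrised by the distance
    [s > 0] to one of its end points, has at that end point the limit [c] and
    the one-sided derivative [d], taken in the direction into the edge. *)
Definition edge_data (g : R -> C) (c d : C) : Prop :=
  filterlim g (at_right 0) (locally c) /\
  filterlim (fun s => ((g s - c) / RtoC s)%C) (at_right 0) (locally d).

(** [f'' + k^2 f = 0] at every point of [E], which is meant to be open. *)
Definition helmholtz_on (E : R -> Prop) (k : R) (f : R -> C) : Prop :=
  exists f1 : R -> C, forall x, E x ->
    is_derive f x (f1 x) /\ is_derive f1 x (- (RtoC (k ^ 2) * f x))%C.

(** [e^{iy}] for real [y]. *)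
Definition expi (y : R) : C := (cos y, sin y).

Inductive vertex_type : Set := TypeI | TypeII.

Definition proportional_weighted_sum0 (theta1 theta2 theta3 : R)
    (a b : C * C * C) : Prop :=
  let '(a1, a2, a3) := a in
  let '(b1, b2, b3) := b in
  (a1 / RtoC theta1 = a2 / RtoC theta2)%C /\
  (a2 / RtoC theta2 = a3 / RtoC theta3)%C /\
  (RtoC theta1 * b1 + RtoC theta2 * b2 + RtoC theta3 * b3 = 0)%C.

(** [p] collects the limits and [d] the derivatives at the vertex, in the order
    left channel edge, right channel edge, resonator edge. *)
Definition vertex_condition (ty : vertex_type) (theta1 theta2 theta3 : R)
    (p d : C * C * C) : Prop :=
  match ty with
  | TypeI => proportional_weighted_sum0 theta1 theta2 theta3 p d
  | TypeII => proportional_weighted_sum0 theta1 theta2 theta3 d p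
  end.

(** A function on the metric graph.  The resonators are numbered from 0, so that
    the vertex of the [j]-th one is at [j * h] with [j < N].  The values of
    [channel] at these points are irrelevant: only its one-sided limits there
    matter, and they need not agree. *)
Record graph_function := GraphFunction {
  channel : R -> C;
  resonator : nat -> R -> C
}.

Definition vertex_pos (h : R) (j : nat) : R := INR j * h.

(** The union of the open channel edges. *)
Definition channel_interior (N : nat) (h x : R) : Prop :=
  forall j : nat, (j < N)%nat -> x <> vertex_pos h j.

Definition satisfies_equation (N : nat) (h l k : R) (psi : graph_function) : Prop :=
  helmholtz_on (channel_interior N h) k (channel psi) /\
  forall j : nat, (j < N)%nat ->
    helmholtz_on (fun s => 0 < s < l) k (resonator psi j).

Definition satisfies_vertex_conditions (N : nat) (h : R) (ty : vertex_type)
    (theta1 theta2 theta3 : R) (psi : graph_function) : Prop :=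
  forall j : nat, (j < N)%nat ->
    exists p1 p2 p3 d1 d2 d3 : C,
      edge_data (fun s => channel psi (vertex_pos h j - s)) p1 d1 /\
      edge_data (fun s => channel psi (vertex_pos h j + s)) p2 d2 /\
      edge_data (resonator psi j) p3 d3 /\
      vertex_condition ty theta1 theta2 theta3 (p1, p2, p3) (d1, d2, d3).

(** The derivative [d] into the edge at its far end is [- dpsi/ds]. *)
Definition satisfies_endpoint_conditions (N : nat) (l alpha beta : R)
    (psi : graph_function) : Prop :=
  forall j : nat, (j < N)%nat ->
    exists c d : C,
      edge_data (fun s => resonator psi j (l - s)) c d /\
      (RtoC alpha * c + RtoC beta * (- d) = 0)%C.

Definition scattering_solution (N : nat) (h l : R) (ty : vertex_type)
    (theta1 theta2 theta3 alpha beta k : R) (psi : graph_function) (r t : C) : Prop :=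
  satisfies_equation N h l k psi /\
  satisfies_vertex_conditions N h ty theta1 theta2 theta3 psi /\
  satisfies_endpoint_conditions N l alpha beta psi /\
  (forall x, x < 0 ->
     channel psi x = (expi (k * x) + r * expi (- (k * x)))%C) /\
  (forall x, vertex_pos h (N - 1) < x -> channel psi x = (t * expi (k * x))%C).

(** The amplitudes [(r, t)], by description: they are uniquely determined
    although the scattering solution itself need not be unique. *)
Definition amplitudes (N : nat) (h l : R) (ty : vertex_type)
    (theta1 theta2 theta3 alpha beta k : R) : C * C :=
  epsilon (inhabits (RtoC 0, RtoC 0)) (fun rt =>
    exists psi, scattering_solution N h l ty theta1 theta2 theta3 alpha beta k
                  psi (fst rt) (snd rt)).

Definition transmission (N : nat) (h l : R) (ty : vertex_type)
    (theta1 theta2 theta3 alpha beta k : R) : R :=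
  Cmod (snd (amplitudes N h l ty theta1 theta2 theta3 alpha beta k)) ^ 2.

Definition rational (x : R) : Prop := exists q : Q, x = Q2R q.

Definition periodic_pos (T : R -> R) : Prop :=
  exists P : R, 0 < P /\ forall k, 0 < k -> T (k + P) = T k.

Definition closed_discrete (D : R * R -> Prop) : Prop :=
  closed D /\ forall p, D p -> locally p (fun q => D q -> q = p).

(** Periodicity of a function on the complement of [D] includes the invariance
    of [D] under the periods.  As [D] is closed, continuity of the restriction
    of [F] to the complement is continuity of [F] at each point outside [D]. *)
Definition two_frequency_quasi_periodic (l h : R) (T : R -> R) : Prop :=
  exists (D : R * R -> Prop) (F : R * R -> R),
    closed_discrete D /\
    (forall x y, D (x + PI, y) <-> D (x, y)) /\
    (forall x y, D (x, y + PI) <-> D (x, y)) /\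
    (forall p, ~ D p -> continuous F p) /\
    (forall x y, ~ D (x, y) -> F (x + PI, y) = F (x, y)) /\
    (forall x y, ~ D (x, y) -> F (x, y + PI) = F (x, y)) /\
    (forall k, 0 < k -> ~ D (k * l, k * h) /\ T k = F (k * l, k * h)).

(* Main.v *)
Require Import Defs.
From Stdlib Require Import Reals Lra Lia ZArith QArith Qreals ClassicalEpsilon.
From Coquelicot Require Import Coquelicot.
Open Scope R_scope.

(** On an edge a solution is [u cos(kx) + w sin(kx)] and is recorded by the state
    [(u, w)], whose one-sided data at the centre are [(u, k w)].  Running along an
    edge of length [h] rotates the state by the angle [k h].  On a resonator the
    Neumann or Dirichlet condition leaves one free amplitude, with states
    [A (cos phi, sin phi)], [phi = k l] or [phi = k l - PI/2].  Eliminating [A]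
    from the vertex condition gives a relation between the states to the left and
    to the right of the vertex from which [k] has disappeared, apart from [k l]
    and [k h].  Conditions of type II become conditions of type I (with
    [- theta2] and [phi + PI/2]) for the quarter-turned state [(- i w, i u)], so
    that a single relation [vertex_rel], with phase [x = k l + delta] where
    [delta] is a multiple of [PI/2], covers all four cases
    ([resonator_rel_turn]).

    A scattering solution is the same thing as a chain of related states
    ([scattering_chain], [chain_scattering]).  The relation at a vertex multiplied
    by [cos x] is a real matrix [B(x)] of determinant [cos^2 x].  With [M] the
    [N]-th power of [B(x)] followed by the rotation by [y = k h], of entries
    [m11], [m12], [m21], [m22], matching with [e^{ikx} + r e^{-ikx}] on the left
    and [t e^{ikx}] on the right gives
      [2 cos^N x = t (m11 + m22 + i (m21 - m12))] up to a phase of [t],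
    hence
      [|t|^2 = 4 cos^{2N} x / ((m11 + m22)^2 + (m21 - m12)^2)],
    which is the function [profile] ([chain_transmission]).  It is
    invariant under [x -> x + PI] and [y -> y + PI] because [M] only changes sign,
    which settles the commensurate case.

    The denominator equals [|M|^2 + 2 cos^{2N} x] with the Frobenius norm, so it
    can vanish only where [cos x = 0]; there [M] is explicit and vanishes only if
    [sin y = 0] too ([cell_den_pos]).  Outside the lattice
    [cos x = 0 = sin y] the profile is therefore continuous; the ray
    [(k l, k h)], [k > 0], can meet that lattice only if [l / h] is rational
    ([trapped_rational]). *)

(** * Waves on an edge *)

(** [S = (f, f'/k)] at the point taken as origin. *)
Definition wave (k : R) (S : C * C) (x : R) : C :=
  (fst S * RtoC (cos (k * x)) + snd S * RtoC (sin (k * x)))%C.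

(** The state [(u, w)] read after the phase [y]. *)
Definition rot (y : R) (S : C * C) : C * C :=
  ((fst S * RtoC (cos y) + snd S * RtoC (sin y))%C,
   (snd S * RtoC (cos y) - fst S * RtoC (sin y))%C).

Lemma C_ext (z w : C) : fst z = fst w -> snd z = snd w -> z = w.
Proof. apply injective_projections. Qed.

Lemma is_derive_C (f : R -> C) (x : R) (d : C) :
  is_derive f x d <->
  is_derive (fun y => fst (f y)) x (fst d) /\ is_derive (fun y => snd (f y)) x (snd d).
Proof.
  split.
  - intros Hf; split.
    + refine (filterdiff_comp' f (@fst R R) x _ (@fst R R) Hf _).
      apply filterdiff_linear, is_linear_fst.
    + refine (filterdiff_comp' f (@snd R R) x _ (@snd R R) Hf _).
      apply filterdiff_linear, is_linear_snd.
  - intros [H1 H2].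
    pose proof (is_derive_plus _ _ _ _ _
      (is_derive_scal_l _ _ _ ((1, 0) : R * R) H1)
      (is_derive_scal_l _ _ _ ((0, 1) : R * R) H2)) as H.
    replace d with (plus (scal (fst d) ((1, 0) : R * R)) (scal (snd d) ((0, 1) : R * R))).
    + refine (is_derive_ext _ _ _ _ _ H).
      intros t; apply C_ext; unfold plus, scal; simpl;
        unfold prod_plus, prod_scal, plus, scal; simpl; unfold mult; simpl; ring.
    + apply C_ext; unfold plus, scal; simpl;
        unfold prod_plus, prod_scal, plus, scal; simpl; unfold mult; simpl; ring.
Qed.

Lemma constant_of_derive_zero (G : R -> R) (a b : R) :
  (forall x, a < x < b -> is_derive G x 0) ->
  forall x y, a < x < b -> a < y < b -> G x = G y.
Proof.
  intros HG.
  assert (Hlt : forall x y, a < x < b -> a < y < b -> x < y -> G x = G y).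
  { intros x y Hx Hy Hxy; apply (eq_is_derive G x y); [|exact Hxy].
    intros t Ht; apply HG; lra. }
  intros x y Hx Hy; destruct (Rtotal_order x y) as [H | [-> | H]]; auto.
  symmetry; auto.
Qed.

(** The state read at the point [c] is a constant of motion: rotating
    [(f, f'/k)] back by the angle [k (x - c)] gives two functions with zero
    derivative. *)
Lemma helmholtz_interval_real (k a b c : R) (f f1 : R -> R) :
  k <> 0 -> a < b ->
  (forall x, a < x < b -> is_derive f x (f1 x) /\ is_derive f1 x (- (k ^ 2 * f x))) ->
  exists u w, forall x, a < x < b ->
    f x = u * cos (k * (x - c)) + w * sin (k * (x - c)).
Proof.
  intros Hk Hab Hf.
  set (G x := f x * cos (k * (x - c)) - f1 x / k * sin (k * (x - c))).
  set (H x := f x * sin (k * (x - c)) + f1 x / k * cos (k * (x - c))).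
  assert (HG : forall x, a < x < b -> is_derive G x 0).
  { intros x Hx; destruct (Hf x Hx) as [H1 H2]; unfold G.
    auto_derive.
    - repeat split; eexists; eassumption.
    - rewrite (is_derive_unique (fun x : R => f x) _ _ H1),
        (is_derive_unique (fun x : R => f1 x) _ _ H2).
      field; exact Hk. }
  assert (HH : forall x, a < x < b -> is_derive H x 0).
  { intros x Hx; destruct (Hf x Hx) as [H1 H2]; unfold H.
    auto_derive.
    - repeat split; eexists; eassumption.
    - rewrite (is_derive_unique (fun x : R => f x) _ _ H1),
        (is_derive_unique (fun x : R => f1 x) _ _ H2).
      field; exact Hk. }
  exists (G ((a + b) / 2)), (H ((a + b) / 2)); intros x Hx.
  rewrite (constant_of_derive_zero G a b HG ((a + b) / 2) x) by lra.
  rewrite (constant_of_derive_zero H a b HH ((a + b) / 2) x) by lra.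
  unfold G, H.
  pose proof (sin2_cos2 (k * (x - c))) as Hsc; unfold Rsqr in Hsc.
  transitivity (f x * (sin (k * (x - c)) * sin (k * (x - c)) +
                       cos (k * (x - c)) * cos (k * (x - c)))); [rewrite Hsc | ]; ring.
Qed.

Lemma helmholtz_interval (k a b c : R) (f : R -> C) :
  k <> 0 -> a < b -> helmholtz_on (fun x => a < x < b) k f ->
  exists S, forall x, a < x < b -> f x = wave k S (x - c).
Proof.
  intros Hk Hab [f1 Hf].
  destruct (helmholtz_interval_real k a b c (fun x => fst (f x)) (fun x => fst (f1 x)) Hk Hab)
    as [u1 [w1 H1]].
  { intros x Hx; destruct (Hf x Hx) as [Ha Hb]; apply is_derive_C in Ha; apply is_derive_C in Hb.
    split; [apply Ha |]. destruct Hb as [Hb _]; simpl in Hb.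
    replace (- (k ^ 2 * fst (f x))) with (- (k * (k * 1) * fst (f x) - 0 * snd (f x))) by ring.
    exact Hb. }
  destruct (helmholtz_interval_real k a b c (fun x => snd (f x)) (fun x => snd (f1 x)) Hk Hab)
    as [u2 [w2 H2]].
  { intros x Hx; destruct (Hf x Hx) as [Ha Hb]; apply is_derive_C in Ha; apply is_derive_C in Hb.
    split; [apply Ha |]. destruct Hb as [_ Hb]; simpl in Hb.
    replace (- (k ^ 2 * snd (f x))) with (- (k * (k * 1) * snd (f x) + 0 * fst (f x))) by ring.
    exact Hb. }
  exists ((u1, u2), (w1, w2)); intros x Hx; apply C_ext; simpl.
  - rewrite (H1 x Hx); ring.
  - rewrite (H2 x Hx); ring.
Qed.

Lemma wave_helmholtz (E : R -> Prop) (k c : R) (S : C * C) :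
  helmholtz_on E k (fun x => wave k S (x - c)).
Proof.
  exists (fun x => RtoC k * snd (rot (k * (x - c)) S))%C; intros x _.
  destruct S as [[u1 u2] [w1 w2]].
  split; apply is_derive_C; split; simpl; auto_derive; trivial;
    unfold Rminus; ring.
Qed.

Lemma wave_shift (k a b : R) (S : C * C) :
  wave k S (a + b) = wave k (rot (k * a) S) b.
Proof.
  unfold wave, rot; simpl fst; simpl snd.
  rewrite Rmult_plus_distr_l, cos_plus, sin_plus.
  rewrite ?RtoC_plus, ?RtoC_minus, ?RtoC_mult; ring.
Qed.

(** Only the germ at the end point matters; this transfers the data of explicit
    waves to solutions known on open edges only. *)
Lemma edge_data_germ (f g : R -> C) (c d : C) (e : R) :
  0 < e -> (forall s, 0 < s < e -> f s = g s) -> edge_data f c d -> edge_data g c d.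
Proof.
  intros He Hfg [H1 H2].
  assert (Hloc : at_right 0 (fun s => f s = g s)).
  { exists (mkposreal e He); intros y Hy Hy0; apply Hfg; split; [exact Hy0|].
    unfold ball in Hy; simpl in Hy; unfold AbsRing_ball, abs, minus, plus, opp in Hy;
      simpl in Hy.
    rewrite Ropp_0, Rplus_0_r, Rabs_pos_eq in Hy; lra. }
  split.
  - exact (filterlim_ext_loc _ _ Hloc H1).
  - refine (filterlim_ext_loc _ _ _ H2).
    revert Hloc; apply filter_imp; intros s ->; reflexivity.
Qed.

Lemma edge_data_unique (f : R -> C) (c d c' d' : C) :
  edge_data f c d -> edge_data f c' d' -> c = c' /\ d = d'.
Proof.
  intros [H1 H2] [H1' H2'].
  assert (Hc : c = c').
  { exact (@filterlim_locally_unique R R_AbsRing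
             (prod_NormedModule R_AbsRing R_NormedModule R_NormedModule)
             (at_right 0) _ f c c' H1 H1'). }
  subst c'; split; [reflexivity|].
  exact (@filterlim_locally_unique R R_AbsRing
           (prod_NormedModule R_AbsRing R_NormedModule R_NormedModule)
           (at_right 0) _ _ d d' H2 H2').
Qed.

Lemma filterlim_C (f : R -> C) (F : (R -> Prop) -> Prop) {HF : Filter F} (c : C) :
  filterlim (fun s => fst (f s)) F (locally (fst c)) ->
  filterlim (fun s => snd (f s)) F (locally (snd c)) ->
  filterlim f F (locally c).
Proof.
  intros H1 H2.
  apply filterlim_locally; intros eps.
  pose proof (proj1 (filterlim_locally _ _) H1 eps) as K1.
  pose proof (proj1 (filterlim_locally _ _) H2 eps) as K2.
  generalize (filter_and _ _ K1 K2); apply filter_imp; intros s Hs; exact Hs.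
Qed.

Lemma derive_right_quotient (g : R -> R) (d : R) :
  is_derive g 0 d -> filterlim (fun s => (g s - g 0) / s) (at_right 0) (locally d).
Proof.
  intros Hg; apply is_derive_Reals in Hg.
  apply filterlim_locally; intros eps.
  destruct (Hg eps (cond_pos eps)) as [delta Hd].
  exists delta; intros y Hy Hy0.
  unfold ball in *; simpl in *; unfold AbsRing_ball, abs, minus, plus, opp in *; simpl in *.
  rewrite Ropp_0, Rplus_0_r in Hy.
  specialize (Hd y (Rgt_not_eq _ _ Hy0) Hy); rewrite Rplus_0_l in Hd; exact Hd.
Qed.

Lemma edge_data_of_derive (g : R -> C) (d : C) :
  is_derive g 0 d -> edge_data g (g 0) d.
Proof.
  intros Hg; apply is_derive_C in Hg; destruct Hg as [H1 H2]; split.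
  - assert (Hc : forall f : R -> R, ex_derive f 0 ->
              filterlim f (at_right 0) (locally (f 0))).
    { intros f Hf; apply (filterlim_filter_le_1 f (F := locally 0)).
      - apply filter_le_within.
      - exact (ex_derive_continuous f 0 Hf). }
    apply filterlim_C; [apply at_right_proper_filter| |].
    + apply (Hc (fun s => fst (g s))); eexists; eassumption.
    + apply (Hc (fun s => snd (g s))); eexists; eassumption.
  - apply filterlim_C; [apply at_right_proper_filter| |].
    + refine (filterlim_ext_loc _ _ _ (derive_right_quotient _ _ H1)).
      exists (mkposreal 1 Rlt_0_1); intros s _ Hs; simpl; field; lra.
    + refine (filterlim_ext_loc _ _ _ (derive_right_quotient _ _ H2)).
      exists (mkposreal 1 Rlt_0_1); intros s _ Hs; simpl; field; lra.
Qed.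

Lemma wave_edge_right (k : R) (S : C * C) :
  edge_data (wave k S) (fst S) (RtoC k * snd S).
Proof.
  assert (H : edge_data (wave k S) (wave k S 0) (RtoC k * snd S)).
  { apply edge_data_of_derive, is_derive_C; destruct S as [[u1 u2] [w1 w2]]; split; simpl;
      auto_derive; trivial; rewrite Rmult_0_r, sin_0, cos_0; ring. }
  replace (fst S) with (wave k S 0); [exact H|].
  unfold wave; rewrite Rmult_0_r, sin_0, cos_0; ring.
Qed.

Lemma wave_edge_left (k : R) (S : C * C) :
  edge_data (fun s => wave k S (- s)) (fst S) (- (RtoC k * snd S)).
Proof.
  refine (edge_data_germ (wave k (fst S, (- snd S)%C)) _ _ _ 1 Rlt_0_1 _ _).
  - intros s _; unfold wave; simpl fst; simpl snd.
    replace (k * - s) with (- (k * s)) by ring.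
    rewrite cos_neg, sin_neg, RtoC_opp; ring.
  - replace (- (RtoC k * snd S))%C with (RtoC k * snd (fst S, - snd S))%C by (simpl; ring).
    exact (wave_edge_right k (fst S, (- snd S)%C)).
Qed.

(** * Vertices and chains of cells *)

(** The vertex condition with a resonator of free amplitude [A].  The left data
    carry a minus sign because derivatives point into the edge, whereas states are
    read in the direction of increasing [x]. *)
Definition resonator_rel (ty : vertex_type) (theta1 theta2 theta3 phi k : R)
    (S S' : C * C) : Prop :=
  exists A : C,
    vertex_condition ty theta1 theta2 theta3
      (fst S, fst S', (A * RtoC (cos phi))%C)
      ((- (RtoC k * snd S))%C, (RtoC k * snd S')%C, (RtoC k * (A * RtoC (sin phi)))%C).

(** Type I conditions with the wavenumber divided out. *)
Definition vertex_rel (theta1 sigma theta3 x : R) (S S' : C * C) : Prop :=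
  exists A : C,
    (fst S' * RtoC theta1 = RtoC sigma * fst S)%C /\
    (A * RtoC (cos x) * RtoC theta1 = RtoC theta3 * fst S)%C /\
    (RtoC theta1 * snd S = RtoC sigma * snd S' + RtoC theta3 * (A * RtoC (sin x)))%C.

(** [chain V y n S0 S]: the state [S0] arriving at the first vertex can become
    [S] after [n] cells, each made of a vertex obeying [V] and an edge of phase
    [y].  A relation is needed, not a matrix: where the resonator phase has cosine
    zero, the vertex does not determine the outgoing state. *)
Fixpoint chain (V : C * C -> C * C -> Prop) (y : R) (n : nat) (S0 S : C * C) : Prop :=
  match n with
  | O => S = S0
  | Datatypes.S m => exists S1 S2, chain V y m S0 S1 /\ V S1 S2 /\ S = rot y S2
  end.

(** For a wave [psi], [(- i w, i u)] is the state of [psi' / (i k)], for which the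
    roles of values and derivatives are exchanged.  The factor [i] keeps outgoing
    waves [(t, i t)] fixed. *)
Definition turn (ty : vertex_type) (S : C * C) : C * C :=
  match ty with
  | TypeI => S
  | TypeII => ((- Ci * snd S)%C, (Ci * fst S)%C)
  end.

Definition turned_theta (ty : vertex_type) (theta2 : R) : R :=
  match ty with TypeI => theta2 | TypeII => - theta2 end.

Definition turn_shift (ty : vertex_type) : R :=
  match ty with TypeI => 0 | TypeII => PI / 2 end.

Lemma RtoC_neq0 (x : R) : x <> 0 -> RtoC x <> RtoC 0.
Proof. intros Hx H; apply Hx; injection H; trivial. Qed.

Lemma Ci2 : (Ci * Ci = - 1)%C.
Proof. apply C_ext; simpl; ring. Qed.

Lemma Ci_neq0 : Ci <> RtoC 0.
Proof. intros H; injection H; lra. Qed.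

Lemma turn_turn (ty : vertex_type) (S : C * C) : turn ty (turn ty S) = S.
Proof.
  destruct ty; [reflexivity|]; destruct S as [u w]; unfold turn; simpl fst; simpl snd.
  f_equal.
  - transitivity (- (Ci * Ci) * u)%C; [ring | rewrite Ci2; ring].
  - transitivity (- (Ci * Ci) * w)%C; [ring | rewrite Ci2; ring].
Qed.

Lemma turn_rot (ty : vertex_type) (y : R) (S : C * C) : turn ty (rot y S) = rot y (turn ty S).
Proof. destruct ty; [reflexivity|]; unfold turn, rot; simpl fst; simpl snd; f_equal; ring. Qed.

Lemma Cdiv_eq_iff (a b c d : C) :
  b <> RtoC 0 -> d <> RtoC 0 -> (a / b = c / d <-> a * d = c * b)%C.
Proof.
  intros Hb Hd; split; intros H.
  - transitivity (a / b * (b * d))%C; [field; exact Hb | rewrite H; field; exact Hd].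
  - transitivity (a * d / (b * d))%C; [field; auto | rewrite H; field; auto].
Qed.

Lemma Cmult_cancel (a b c : C) : a <> RtoC 0 -> (a * b = a * c -> b = c)%C.
Proof.
  intros Ha H. transitivity (/ a * (a * b))%C; [field; exact Ha | rewrite H; field; exact Ha].
Qed.

Lemma Cminus_eq0 (a b : C) : (a - b = 0 -> a = b)%C.
Proof. intros H; transitivity (a - b + b)%C; [ring | rewrite H; ring]. Qed.

(** Exchanging values and derivatives reverses the relative sign of the two channel
    edges, since one of them runs against [x]: this is the sign of
    [turned_theta].  On the resonator it exchanges sine and cosine, that is,
    shifts the phase by [PI/2]. *)
Lemma resonator_rel_turn (ty : vertex_type) (theta1 theta2 theta3 phi k : R) (S S' : C * C) :
  theta1 <> 0 -> theta2 <> 0 -> theta3 <> 0 -> k <> 0 ->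
  resonator_rel ty theta1 theta2 theta3 phi k S S' <->
  vertex_rel theta1 (turned_theta ty theta2) theta3 (phi + turn_shift ty)
    (turn ty S) (turn ty S').
Proof.
  intros H1 H2 H3 Hk.
  apply RtoC_neq0 in H1; apply RtoC_neq0 in H2; apply RtoC_neq0 in H3; apply RtoC_neq0 in Hk.
  pose proof Ci_neq0 as Hi. pose proof Ci2 as Hi2.
  destruct S as [u w], S' as [u' w'].
  unfold resonator_rel, vertex_rel, vertex_condition, proportional_weighted_sum0.
  destruct ty; unfold turn, turned_theta, turn_shift; simpl fst; simpl snd.
  - rewrite Rplus_0_r.
    assert (E : forall A : C,
      (RtoC theta1 * - (RtoC k * w) + RtoC theta2 * (RtoC k * w') +
         RtoC theta3 * (RtoC k * (A * RtoC (sin phi))) =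
       RtoC k * (RtoC theta2 * w' + RtoC theta3 * (A * RtoC (sin phi)) - RtoC theta1 * w))%C)
      by (intros; ring).
    split; intros [A [Ha [Hb Hc]]]; exists A.
    + rewrite Cdiv_eq_iff in Ha, Hb by assumption.
      split; [|split].
      * rewrite <- Ha; ring.
      * apply (Cmult_cancel (RtoC theta2)); [assumption|].
        transitivity (A * RtoC (cos phi) * RtoC theta2 * RtoC theta1)%C; [ring|].
        rewrite <- Hb.
        transitivity (u' * RtoC theta1 * RtoC theta3)%C; [ring|]; rewrite <- Ha; ring.
      * symmetry; apply Cminus_eq0, (Cmult_cancel (RtoC k)); [assumption|].
        rewrite <- E, Hc; ring.
    + rewrite !Cdiv_eq_iff by assumption.
      split; [|split].
      * rewrite Ha; ring.
      * apply (Cmult_cancel (RtoC theta1)); [assumption|].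
        transitivity (u' * RtoC theta1 * RtoC theta3)%C; [ring|]; rewrite Ha.
        transitivity (RtoC theta2 * (RtoC theta3 * u))%C; [ring|]; rewrite <- Hb; ring.
      * rewrite E, Hc; ring.
  - rewrite cos_plus, sin_plus, cos_PI2, sin_PI2.
    rewrite !Rmult_0_r, !Rmult_1_r, Rplus_0_l, RtoC_opp, RtoC_minus.
    split.
    + intros [A [Ha [Hb Hc]]]; exists (- Ci * A)%C.
      rewrite Cdiv_eq_iff in Ha, Hb by assumption.
      assert (Ha' : (w * RtoC theta2 = - (w' * RtoC theta1))%C).
      { apply (Cmult_cancel (- RtoC k)); [intros E; apply Hk; transitivity (- - RtoC k)%C;
          [ring | rewrite E; ring]|].
        transitivity (- (RtoC k * w) * RtoC theta2)%C; [ring|]; rewrite Ha; ring. }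
      assert (Hb' : (w' * RtoC theta3 = A * RtoC (sin phi) * RtoC theta2)%C).
      { apply (Cmult_cancel (RtoC k)); [assumption|].
        transitivity (RtoC k * w' * RtoC theta3)%C; [ring|]; rewrite Hb; ring. }
      split; [|split].
      * transitivity (Ci * (- (w' * RtoC theta1)))%C; [ring|]; rewrite <- Ha'; ring.
      * apply (Cmult_cancel (RtoC theta2)); [assumption|].
        transitivity (Ci * RtoC theta1 * (A * RtoC (sin phi) * RtoC theta2))%C; [ring|].
        rewrite <- Hb'.
        transitivity (- Ci * RtoC theta3 * - (w' * RtoC theta1))%C; [ring|].
        rewrite <- Ha'; ring.
      * apply Cminus_eq0.
        transitivity (Ci * (RtoC theta1 * u + RtoC theta2 * u' +
                            RtoC theta3 * (A * RtoC (cos phi))))%C; [ring|].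
        rewrite Hc; ring.
    + intros [A [Ha [Hb Hc]]]; exists (Ci * A)%C.
      rewrite !Cdiv_eq_iff by assumption.
      assert (Ha' : (w * RtoC theta2 = - (w' * RtoC theta1))%C).
      { apply (Cmult_cancel Ci); [assumption|].
        transitivity (- RtoC theta2 * (- Ci * w))%C; [ring|]; rewrite <- Ha; ring. }
      split; [|split].
      * transitivity (- RtoC k * (w * RtoC theta2))%C; [ring|]; rewrite Ha'; ring.
      * apply (Cmult_cancel (RtoC theta1)); [assumption|].
        transitivity (- RtoC k * RtoC theta3 * - (w' * RtoC theta1))%C; [ring|].
        rewrite <- Ha'.
        transitivity (- (Ci * Ci) * (- RtoC k * RtoC theta3 * w * RtoC theta2))%C;
          [rewrite Hi2; ring|].
        transitivity (- Ci * RtoC k * RtoC theta2 * (RtoC theta3 * (- Ci * w)))%C;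
          [ring|]; rewrite <- Hb; ring.
      * apply (Cmult_cancel Ci); [assumption|].
        transitivity (RtoC theta1 * (Ci * u) + RtoC theta2 * (Ci * u') +
                      (Ci * Ci) * (RtoC theta3 * A * RtoC (cos phi)))%C; [ring|].
        rewrite Hc, Hi2; ring.
Qed.

Lemma chain_turn (V W : C * C -> C * C -> Prop) (ty : vertex_type) (y : R) (n : nat)
    (S0 S : C * C) :
  (forall S1 S2, V S1 S2 -> W (turn ty S1) (turn ty S2)) ->
  chain V y n S0 S -> chain W y n (turn ty S0) (turn ty S).
Proof.
  intros HVW; revert S; induction n as [|n IH]; intros S; simpl.
  - intros ->; reflexivity.
  - intros [S1 [S2 [H1 [H2 ->]]]]; exists (turn ty S1), (turn ty S2).
    split; [apply IH, H1 | split; [apply HVW, H2 | apply turn_rot]].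
Qed.

(** * The transfer matrix *)

(** The action of one cell on states, multiplied by [cos x].  Clearing the
    denominator keeps it defined, and equal to a trigonometric polynomial, where
    the resonator blocks the channel.  At a vertex obeying [vertex_rel] the
    parameters are [rho = sigma / theta1] and
    [kappa = theta3^2 / (theta1 sigma)]. *)
Fixpoint cell_iter (rho kappa x y : R) (n : nat) (v : R * R) : R * R :=
  match n with
  | O => v
  | S m =>
      let u := fst (cell_iter rho kappa x y m v) in
      let w := snd (cell_iter rho kappa x y m v) in
      let u' := rho * cos x * u in
      let w' := / rho * cos x * w - kappa * sin x * u in
      (u' * cos y + w' * sin y, w' * cos y - u' * sin y)
  end.

Definition m11 (rho kappa x y : R) (n : nat) : R := fst (cell_iter rho kappa x y n (1, 0)).
Definition m21 (rho kappa x y : R) (n : nat) : R := snd (cell_iter rho kappa x y n (1, 0)).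
Definition m12 (rho kappa x y : R) (n : nat) : R := fst (cell_iter rho kappa x y n (0, 1)).
Definition m22 (rho kappa x y : R) (n : nat) : R := snd (cell_iter rho kappa x y n (0, 1)).

Lemma cell_det (rho kappa x y : R) (Hrho : rho <> 0) (n : nat) :
  m11 rho kappa x y n * m22 rho kappa x y n - m12 rho kappa x y n * m21 rho kappa x y n =
    (cos x ^ n) ^ 2.
Proof.
  unfold m11, m21, m12, m22.
  induction n as [|n IH]; simpl cell_iter; simpl fst; simpl snd; [simpl; ring|].
  destruct (cell_iter rho kappa x y n (1, 0)) as [a c].
  destruct (cell_iter rho kappa x y n (0, 1)) as [b d]; simpl fst in *; simpl snd in *.
  transitivity ((a * d - b * c) * (cos x) ^ 2 * (sin y * sin y + cos y * cos y)).
  - field; exact Hrho.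
  - pose proof (sin2_cos2 y) as E; unfold Rsqr in E; rewrite E, IH; simpl; ring.
Qed.

(** At [cos x = 0] the cell matrix has only its first column left, so its powers
    are scalar multiples of it. *)
Lemma cell_resonance (rho kappa x y : R) (n : nat) :
  cos x = 0 -> m11 rho kappa x y n = (- (kappa * sin x * sin y)) ^ n.
Proof.
  intros Hx; unfold m11; induction n as [|n IH]; simpl; [reflexivity|].
  rewrite IH, Hx; ring.
Qed.

(** [|m11 + m22 + i (m21 - m12)|^2], the denominator of the transmission. *)
Definition cell_den (rho kappa x y : R) (n : nat) : R :=
  (m11 rho kappa x y n + m22 rho kappa x y n) ^ 2 +
  (m21 rho kappa x y n - m12 rho kappa x y n) ^ 2.

(** The determinant identity trades the cross terms for [cos^{2n} x], which makes
    positivity visible. *)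
Lemma cell_den_frobenius (rho kappa x y : R) (Hrho : rho <> 0) (n : nat) :
  cell_den rho kappa x y n =
    m11 rho kappa x y n ^ 2 + m12 rho kappa x y n ^ 2 +
    m21 rho kappa x y n ^ 2 + m22 rho kappa x y n ^ 2 + 2 * (cos x ^ n) ^ 2.
Proof. rewrite <- (cell_det rho kappa x y Hrho); unfold cell_den; ring. Qed.

Lemma cell_den_pos (rho kappa x y : R) (Hrho : rho <> 0) (n : nat) :
  kappa <> 0 -> (cos x <> 0 \/ sin y <> 0) -> 0 < cell_den rho kappa x y n.
Proof.
  intros Hkappa Hxy; rewrite cell_den_frobenius by exact Hrho.
  pose proof (pow2_ge_0 (m11 rho kappa x y n)); pose proof (pow2_ge_0 (m12 rho kappa x y n));
    pose proof (pow2_ge_0 (m21 rho kappa x y n)); pose proof (pow2_ge_0 (m22 rho kappa x y n)).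
  destruct (Req_dec (cos x) 0) as [Hx | Hx].
  - assert (m11 rho kappa x y n <> 0).
    { rewrite (cell_resonance _ _ _ _ n Hx); apply pow_nonzero.
      assert (sin x <> 0).
      { intros E; pose proof (sin2_cos2 x) as E2; unfold Rsqr in E2; rewrite E, Hx in E2; lra. }
      apply Ropp_neq_0_compat; repeat apply Rmult_integral_contrapositive_currified; tauto. }
    pose proof (pow2_gt_0 (m11 rho kappa x y n)); pose proof (pow2_ge_0 (cos x ^ n)); lra.
  - pose proof (pow2_gt_0 _ (pow_nonzero _ n Hx)); lra.
Qed.

(** The amplitude [A] occurs as [A cos x] in one equation and as [A sin x] in the
    other; multiplying the latter by [cos x] eliminates it. *)
Lemma vertex_rel_step (theta1 sigma theta3 x : R) (S S' : C * C) :
  theta1 <> 0 -> sigma <> 0 -> vertex_rel theta1 sigma theta3 x S S' ->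
  (fst S' = RtoC (sigma / theta1) * fst S)%C /\
  (RtoC (cos x) * snd S' =
     RtoC (/ (sigma / theta1) * cos x) * snd S
     - RtoC (theta3 ^ 2 / (theta1 * sigma) * sin x) * fst S)%C.
Proof.
  intros H1 H2 [A [Ha [Hb Hc]]].
  pose proof (RtoC_neq0 _ H1) as H1'; pose proof (RtoC_neq0 _ H2) as H2'.
  destruct S as [u w], S' as [u' w']; simpl fst in *; simpl snd in *.
  split.
  - apply (Cmult_cancel (RtoC theta1)); [assumption|].
    rewrite RtoC_div by assumption.
    transitivity (u' * RtoC theta1)%C; [ring|]; rewrite Ha; field; assumption.
  - replace (/ (sigma / theta1) * cos x) with (theta1 / sigma * cos x) by (field; auto).
    rewrite !RtoC_mult, RtoC_div, RtoC_div, RtoC_mult, RtoC_pow by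
      (repeat apply Rmult_integral_contrapositive_currified; assumption).
    apply (Cmult_cancel (RtoC sigma)); [assumption|].
    assert (E : (RtoC sigma * w' = RtoC theta1 * w - RtoC theta3 * (A * RtoC (sin x)))%C)
      by (rewrite Hc; ring).
    transitivity (RtoC (cos x) * (RtoC sigma * w'))%C; [ring|]; rewrite E.
    transitivity (RtoC (cos x) * RtoC theta1 * w -
      RtoC theta3 * RtoC (sin x) / RtoC theta1 * (A * RtoC (cos x) * RtoC theta1))%C;
      [field; assumption|].
    rewrite Hb; field; auto.
Qed.

Lemma vertex_rel_exists (theta1 sigma theta3 x : R) (S : C * C) :
  theta1 <> 0 -> sigma <> 0 -> cos x <> 0 ->
  exists S', vertex_rel theta1 sigma theta3 x S S'.
Proof.
  intros H1 H2 Hx; apply RtoC_neq0 in H1; apply RtoC_neq0 in H2; apply RtoC_neq0 in Hx.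
  set (A := (RtoC theta3 * fst S / (RtoC (cos x) * RtoC theta1))%C).
  exists ((RtoC sigma * fst S / RtoC theta1)%C,
     ((RtoC theta1 * snd S - RtoC theta3 * (A * RtoC (sin x))) / RtoC sigma)%C), A.
  unfold A; simpl fst; simpl snd; repeat split; field; auto.
Qed.

Lemma chain_exists (V : C * C -> C * C -> Prop) (y : R) (n : nat) (S0 : C * C) :
  (forall S, exists S', V S S') -> exists S, chain V y n S0 S.
Proof.
  intros HV; induction n as [|n [S1 IH]]; [exists S0; reflexivity|].
  destruct (HV S1) as [S2 H2]; exists (rot y S2), S1, S2; auto.
Qed.

Lemma cell_parameters_nonzero (theta1 sigma theta3 : R) :
  theta1 <> 0 -> sigma <> 0 -> theta3 <> 0 ->
  sigma / theta1 <> 0 /\ theta3 ^ 2 / (theta1 * sigma) <> 0.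
Proof.
  intros H1 H2 H3; split; unfold Rdiv; apply Rmult_integral_contrapositive_currified.
  - exact H2.
  - apply Rinv_neq_0_compat, H1.
  - apply pow_nonzero, H3.
  - apply Rinv_neq_0_compat, Rmult_integral_contrapositive_currified; assumption.
Qed.

Lemma chain_linear (theta1 sigma theta3 x y : R) (n : nat) (S0 S : C * C) :
  theta1 <> 0 -> sigma <> 0 ->
  chain (vertex_rel theta1 sigma theta3 x) y n S0 S ->
  let rho := sigma / theta1 in let kappa := theta3 ^ 2 / (theta1 * sigma) in
  (RtoC (cos x ^ n) * fst S =
     RtoC (m11 rho kappa x y n) * fst S0 + RtoC (m12 rho kappa x y n) * snd S0)%C /\
  (RtoC (cos x ^ n) * snd S =
     RtoC (m21 rho kappa x y n) * fst S0 + RtoC (m22 rho kappa x y n) * snd S0)%C.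
Proof.
  intros H1 H2 H rho kappa; revert S H; unfold m11, m12, m21, m22.
  induction n as [|n IH]; intros S; simpl chain; [intros ->|]; simpl cell_iter; simpl fst;
    simpl snd.
  - simpl pow; split; ring.
  - intros [S1 [S2 [Hc [HV ->]]]]; destruct (IH S1 Hc) as [E1 E2].
    destruct (vertex_rel_step _ _ _ _ _ _ H1 H2 HV) as [V1 V2].
    fold rho in V1, V2; fold kappa in V2.
    destruct (cell_iter rho kappa x y n (1, 0)) as [a c].
    destruct (cell_iter rho kappa x y n (0, 1)) as [b d].
    destruct S0 as [u0 w0], S1 as [u1 w1], S2 as [u2 w2]; unfold rot.
    simpl fst in *; simpl snd in *.
    rewrite <- tech_pow_Rmult, RtoC_mult.
    assert (F1 : (RtoC (cos x) * RtoC (cos x ^ n) * u2 =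
       RtoC (rho * cos x) * (RtoC a * u0 + RtoC b * w0))%C).
    { rewrite V1, <- E1, RtoC_mult; ring. }
    assert (F2 : (RtoC (cos x) * RtoC (cos x ^ n) * w2 =
       RtoC (/ rho * cos x) * (RtoC c * u0 + RtoC d * w0)
       - RtoC (kappa * sin x) * (RtoC a * u0 + RtoC b * w0))%C).
    { transitivity (RtoC (cos x ^ n) * (RtoC (cos x) * w2))%C; [ring|].
      rewrite V2, <- E1, <- E2; ring. }
    split.
    + transitivity ((RtoC (cos x) * RtoC (cos x ^ n) * u2) * RtoC (cos y) +
        (RtoC (cos x) * RtoC (cos x ^ n) * w2) * RtoC (sin y))%C; [ring|]; rewrite F1, F2.
      rewrite ?RtoC_plus, ?RtoC_minus, ?RtoC_mult, ?RtoC_minus, ?RtoC_mult; ring.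
    + transitivity ((RtoC (cos x) * RtoC (cos x ^ n) * w2) * RtoC (cos y) -
        (RtoC (cos x) * RtoC (cos x ^ n) * u2) * RtoC (sin y))%C; [ring|]; rewrite F1, F2.
      rewrite ?RtoC_plus, ?RtoC_minus, ?RtoC_mult, ?RtoC_minus, ?RtoC_mult; ring.
Qed.

(** * Scattering amplitudes of a chain *)

(** The states at the origin of [e^{ikx} + r e^{-ikx}] and of [t e^{ikx}]. *)
Definition lead_in (r : C) : C * C := ((1 + r)%C, (Ci * (1 - r))%C).
Definition lead_out (t : C) : C * C := (t, (Ci * t)%C).

Definition profile (rho kappa : R) (N : nat) (x y : R) : R :=
  4 * (cos x ^ N) ^ 2 / cell_den rho kappa x y N.

Lemma Cmod2 (z : C) : Cmod z ^ 2 = fst z ^ 2 + snd z ^ 2.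
Proof.
  unfold Cmod; rewrite pow2_sqrt; [ring|].
  pose proof (pow2_ge_0 (fst z)); pose proof (pow2_ge_0 (snd z)); lra.
Qed.

(** Off resonance, that is for [cos x <> 0], combining the two linear equations
    with the adjugate matrix removes [r].  On resonance the last vertex forces a zero value on its right,
    which an outgoing wave cannot have unless [t = 0]; the profile is zero as
    well, even where its denominator vanishes. *)
Lemma chain_transmission (theta1 sigma theta3 x y : R) (N : nat) (r t : C) :
  theta1 <> 0 -> sigma <> 0 -> theta3 <> 0 -> (1 <= N)%nat ->
  chain (vertex_rel theta1 sigma theta3 x) y N (lead_in r) (lead_out t) ->
  Cmod t ^ 2 = profile (sigma / theta1) (theta3 ^ 2 / (theta1 * sigma)) N x y.
Proof.
  intros H1 H2 H3 HN Hchain.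
  set (rho := sigma / theta1); set (kappa := theta3 ^ 2 / (theta1 * sigma)).
  destruct (cell_parameters_nonzero theta1 sigma theta3 H1 H2 H3) as [Hrho Hkappa].
  fold rho in Hrho; fold kappa in Hkappa.
  unfold profile.
  destruct (Req_dec (cos x) 0) as [Hx | Hx].
  - destruct N as [|N]; [lia|].
    destruct Hchain as [S1 [S2 [_ [[A [Ha [Hb _]]] Hout]]]].
    assert (HU1 : fst S1 = RtoC 0).
    { apply (Cmult_cancel (RtoC theta3)); [apply RtoC_neq0; assumption|].
      rewrite <- Hb, Hx; ring. }
    assert (HU2 : fst S2 = RtoC 0).
    { apply (Cmult_cancel (RtoC theta1)); [apply RtoC_neq0; assumption|].
      transitivity (fst S2 * RtoC theta1)%C; [ring|]; rewrite Ha, HU1; ring. }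
    assert (Ht : t = RtoC 0).
    { apply (f_equal (rot (- y))) in Hout; apply (f_equal fst) in Hout.
      unfold lead_out, rot in Hout; simpl fst in Hout; simpl snd in Hout.
      rewrite HU2, cos_neg, sin_neg, RtoC_opp in Hout.
      assert (E : (t * (RtoC (cos y) - Ci * RtoC (sin y)) = 0)%C).
      { transitivity (t * RtoC (cos y) + Ci * t * - RtoC (sin y))%C; [ring|].
        rewrite Hout; ring. }
      transitivity (t * RtoC (Rsqr (sin y) + Rsqr (cos y)))%C; [rewrite sin2_cos2; ring|].
      unfold Rsqr; rewrite RtoC_plus, !RtoC_mult.
      transitivity (t * (RtoC (cos y) - Ci * RtoC (sin y)) * (RtoC (cos y) + Ci * RtoC (sin y))
        + (1 + Ci * Ci) * t * RtoC (sin y) * RtoC (sin y))%C; [ring|].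
      rewrite E, Ci2; ring. }
    rewrite Ht, Cmod_0, Hx, (pow_i (Datatypes.S N)) by lia; unfold Rdiv; ring.
  - pose proof (chain_linear _ _ _ _ _ _ _ _ H1 H2 Hchain) as HL; cbv zeta in HL.
    fold rho kappa in HL; destruct HL as [E1 E2].
    pose proof (cell_det rho kappa x y Hrho N) as Hdet.
    pose proof (cell_den_pos rho kappa x y Hrho N Hkappa (or_introl Hx)) as Hden.
    unfold cell_den in *.
    set (a := m11 rho kappa x y N) in *; set (b := m12 rho kappa x y N) in *.
    set (c := m21 rho kappa x y N) in *; set (d := m22 rho kappa x y N) in *.
    pose proof (pow_nonzero _ N Hx) as Hg; set (g := cos x ^ N) in *.
    unfold lead_in, lead_out in *; simpl fst in *; simpl snd in *.
    assert (Et : (RtoC (2 * g) = t * (RtoC (a + d) + Ci * RtoC (c - b)))%C).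
    { apply (Cmult_cancel (RtoC g)); [apply RtoC_neq0; assumption|].
      transitivity (RtoC 2 * RtoC (g ^ 2))%C; [rewrite RtoC_mult, RtoC_pow; simpl; ring|].
      rewrite <- Hdet.
      transitivity ((RtoC d + Ci * RtoC c) * (RtoC g * t) -
                    (RtoC b + Ci * RtoC a) * (RtoC g * (Ci * t)))%C.
      - rewrite E1, E2, RtoC_minus, !RtoC_mult.
        transitivity ((RtoC a * RtoC d - RtoC b * RtoC c) * ((1 - Ci * Ci) + (1 + Ci * Ci) * r))%C;
          [rewrite Ci2|]; ring.
      - rewrite RtoC_plus, RtoC_minus.
        transitivity (RtoC g * t * (RtoC d + Ci * RtoC c - Ci * RtoC b - (Ci * Ci) * RtoC a))%C;
          [ring|]; rewrite Ci2; ring. }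
    apply (Rmult_eq_reg_r ((a + d) ^ 2 + (c - b) ^ 2)); [|lra].
    transitivity (4 * g ^ 2); [|field; lra].
    destruct t as [t1 t2]; injection Et as F1 F2; rewrite Cmod2; simpl fst; simpl snd.
    transitivity ((t1 * (a + d) - t2 * (c - b)) ^ 2 + (t1 * (c - b) + t2 * (a + d)) ^ 2);
      [ring|].
    replace (t1 * (a + d) - t2 * (c - b)) with (2 * g) by (rewrite F1; ring).
    replace (t1 * (c - b) + t2 * (a + d)) with 0 by (rewrite F2; ring).
    ring.
Qed.

(** On resonance the first resonator balances the standing wave given by [r = -1],
    and all further states vanish.  Off resonance every vertex can be crossed, and
    [r], [t] solve the two linear matching equations. *)
Lemma chain_amplitudes (theta1 sigma theta3 x y : R) (N : nat) :
  theta1 <> 0 -> sigma <> 0 -> theta3 <> 0 -> (1 <= N)%nat ->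
  exists r t, chain (vertex_rel theta1 sigma theta3 x) y N (lead_in r) (lead_out t).
Proof.
  intros H1 H2 H3 HN.
  destruct (Req_dec (cos x) 0) as [Hx | Hx].
  - exists (- RtoC 1)%C, (RtoC 0).
    replace (lead_out 0) with (RtoC 0, RtoC 0) by (unfold lead_out; f_equal; ring).
    assert (Hs : sin x <> 0).
    { intros E; pose proof (sin2_cos2 x) as E2; unfold Rsqr in E2; rewrite E, Hx in E2; lra. }
    apply RtoC_neq0 in H1; apply RtoC_neq0 in H3; apply RtoC_neq0 in Hs.
    assert (Hrot : (RtoC 0, RtoC 0) = rot y (RtoC 0, RtoC 0))
      by (unfold rot; simpl fst; simpl snd; f_equal; ring).
    destruct N as [|N]; [lia|]; clear HN; induction N as [|N IH].
    + exists (lead_in (- RtoC 1)%C), (RtoC 0, RtoC 0).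
      split; [reflexivity | split; [|exact Hrot]].
      exists (RtoC theta1 * (Ci * RtoC 2) / (RtoC theta3 * RtoC (sin x)))%C.
      unfold lead_in; simpl fst; simpl snd; rewrite Hx.
      split; [ring | split; [ring|]].
      replace (1 - - 1)%C with (RtoC 2) by (apply C_ext; simpl; ring).
      field; auto.
    + exists (RtoC 0, RtoC 0), (RtoC 0, RtoC 0).
      split; [exact IH | split; [|exact Hrot]].
      exists (RtoC 0); simpl fst; simpl snd; repeat split; ring.
  - set (rho := sigma / theta1); set (kappa := theta3 ^ 2 / (theta1 * sigma)).
    destruct (cell_parameters_nonzero theta1 sigma theta3 H1 H2 H3) as [Hrho Hkappa].
    fold rho in Hrho; fold kappa in Hkappa.
    pose proof (cell_det rho kappa x y Hrho N) as Hdet.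
    pose proof (cell_den_pos rho kappa x y Hrho N Hkappa (or_introl Hx)) as Hden.
    pose proof (fun S0 S => chain_linear theta1 sigma theta3 x y N S0 S H1 H2) as HL.
    cbv zeta in HL; fold rho kappa in HL.
    unfold cell_den in *.
    set (a := m11 rho kappa x y N) in *; set (b := m12 rho kappa x y N) in *.
    set (c := m21 rho kappa x y N) in *; set (d := m22 rho kappa x y N) in *.
    pose proof (RtoC_neq0 _ (pow_nonzero _ N Hx)) as Hg; set (g := cos x ^ N) in *.
    set (z' := (RtoC a + RtoC d + Ci * (RtoC c - RtoC b))%C).
    assert (Hz : z' <> RtoC 0).
    { unfold z'; intros E.
      replace (RtoC a + RtoC d + Ci * (RtoC c - RtoC b))%C with (a + d, c - b) in E
        by (apply C_ext; simpl; ring).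
      injection E as E1 E2; rewrite E1, E2 in Hden; simpl in Hden; lra. }
    set (r := (2 * (RtoC d - Ci * RtoC b) / z' - 1)%C).
    exists r, (2 * RtoC g / z')%C.
    destruct (chain_exists (vertex_rel theta1 sigma theta3 x) y N (lead_in r)) as [[U W] HS].
    { intros S; apply vertex_rel_exists; assumption. }
    destruct (HL _ _ HS) as [E1 E2].
    replace (lead_out (2 * RtoC g / z')%C) with (U, W); [exact HS|].
    assert (E : (RtoC a * RtoC d - RtoC b * RtoC c = RtoC g * RtoC g)%C).
    { rewrite <- !RtoC_mult, <- RtoC_minus, Hdet; f_equal; ring. }
    assert (Hr : (1 - r = 2 * (RtoC a + Ci * RtoC c) / z')%C).
    { unfold r; transitivity ((2 * z' - 2 * (RtoC d - Ci * RtoC b)) / z')%C;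
        [field; exact Hz|]; unfold z'; field; exact Hz. }
    unfold lead_in, lead_out in *; simpl fst in *; simpl snd in *; rewrite Hr in E1, E2.
    f_equal; apply (Cmult_cancel (RtoC g)); try assumption; [rewrite E1 | rewrite E2].
    + transitivity (2 * (RtoC a * RtoC d + (Ci * Ci) * (RtoC b * RtoC c)) / z')%C;
        [unfold r; field; exact Hz|].
      rewrite Ci2.
      transitivity (2 * (RtoC a * RtoC d - RtoC b * RtoC c) / z')%C; [field; exact Hz|].
      rewrite E; field; exact Hz.
    + transitivity (2 * (Ci * (RtoC a * RtoC d - RtoC b * RtoC c)
                         + (1 + Ci * Ci) * (RtoC c * RtoC d)) / z')%C;
        [unfold r; field; exact Hz|].
      rewrite E, Ci2; field; exact Hz.
Qed.

(** Differentiation changes the sign of the reflected wave only. *)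
Lemma turn_lead_in (ty : vertex_type) (r : C) :
  turn ty (lead_in (match ty with TypeI => r | TypeII => - r end)%C) = lead_in r.
Proof.
  destruct ty; [reflexivity|]; unfold turn, lead_in; simpl fst; simpl snd; f_equal.
  transitivity (- (Ci * Ci) * (1 + r))%C; [ring | rewrite Ci2; ring].
Qed.

Lemma turn_lead_out (ty : vertex_type) (t : C) : turn ty (lead_out t) = lead_out t.
Proof.
  destruct ty; [reflexivity|]; unfold turn, lead_out; simpl fst; simpl snd; f_equal.
  transitivity (- (Ci * Ci) * t)%C; [ring | rewrite Ci2; ring].
Qed.

(** * Periodicity and continuity of the profile *)

Lemma cell_iter_flip_x (rho kappa x y : R) (n : nat) (v : R * R) :
  cell_iter rho kappa (x + PI) y n v =
    ((- 1) ^ n * fst (cell_iter rho kappa x y n v),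
     (- 1) ^ n * snd (cell_iter rho kappa x y n v)).
Proof.
  induction n as [|n IH]; [destruct v; simpl; f_equal; ring|].
  simpl cell_iter; rewrite IH; simpl fst; simpl snd.
  rewrite neg_cos, neg_sin; simpl pow; f_equal; ring.
Qed.

Lemma cell_iter_flip_y (rho kappa x y : R) (n : nat) (v : R * R) :
  cell_iter rho kappa x (y + PI) n v =
    ((- 1) ^ n * fst (cell_iter rho kappa x y n v),
     (- 1) ^ n * snd (cell_iter rho kappa x y n v)).
Proof.
  induction n as [|n IH]; [destruct v; simpl; f_equal; ring|].
  simpl cell_iter; rewrite IH; simpl fst; simpl snd.
  rewrite neg_cos, neg_sin; simpl pow; f_equal; ring.
Qed.

Lemma pow_neg1_sq (n : nat) : ((- 1) ^ n) ^ 2 = 1.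
Proof. rewrite <- pow_mult, Nat.mul_comm; apply pow_1_even. Qed.

Lemma profile_period_x (rho kappa : R) (N : nat) (x y : R) :
  profile rho kappa N (x + PI) y = profile rho kappa N x y.
Proof.
  unfold profile, cell_den, m11, m12, m21, m22.
  rewrite !cell_iter_flip_x; simpl fst; simpl snd.
  rewrite neg_cos; replace (- cos x) with (- 1 * cos x) by ring; rewrite Rpow_mult_distr.
  pose proof (pow_neg1_sq N) as E.
  f_equal.
  - rewrite Rpow_mult_distr, E; ring.
  - rewrite <- Rmult_plus_distr_l, <- Rmult_minus_distr_l, !(Rpow_mult_distr ((-1) ^ N)), E; ring.
Qed.

Lemma profile_period_y (rho kappa : R) (N : nat) (x y : R) :
  profile rho kappa N x (y + PI) = profile rho kappa N x y.
Proof.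
  unfold profile, cell_den, m11, m12, m21, m22.
  rewrite !cell_iter_flip_y; simpl fst; simpl snd.
  pose proof (pow_neg1_sq N) as E.
  f_equal.
  rewrite <- Rmult_plus_distr_l, <- Rmult_minus_distr_l, !(Rpow_mult_distr ((-1) ^ N)), E; ring.
Qed.

Lemma continuous_Rplus (f g : R * R -> R) (p : R * R) :
  continuous f p -> continuous g p -> continuous (fun q => f q + g q) p.
Proof. exact (continuous_plus (V := R_NormedModule) f g p). Qed.

Lemma continuous_Rminus (f g : R * R -> R) (p : R * R) :
  continuous f p -> continuous g p -> continuous (fun q => f q - g q) p.
Proof. exact (continuous_minus (V := R_NormedModule) f g p). Qed.

Lemma continuous_Rmult (f g : R * R -> R) (p : R * R) :
  continuous f p -> continuous g p -> continuous (fun q => f q * g q) p.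
Proof. exact (continuous_mult (K := R_AbsRing) f g p). Qed.

Lemma continuous_Rpow (f : R * R -> R) (n : nat) (p : R * R) :
  continuous f p -> continuous (fun q => f q ^ n) p.
Proof.
  intros Hf; induction n as [|n IH]; [apply continuous_const|].
  exact (continuous_Rmult f (fun q => f q ^ n) p Hf IH).
Qed.

Lemma continuous_shifted_fst (delta : R) (p : R * R) :
  continuous (fun q : R * R => fst q + delta) p.
Proof.
  destruct p as [px py].
  apply (continuous_Rplus (fun q => fst q) (fun _ => delta));
    [apply continuous_fst | apply continuous_const].
Qed.

Lemma continuous_cos_fst (delta : R) (p : R * R) :
  continuous (fun q : R * R => cos (fst q + delta)) p.
Proof.
  exact (continuous_comp (fun q : R * R => fst q + delta) cos p
           (continuous_shifted_fst delta p) (continuous_cos _)).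
Qed.

Lemma cell_iter_continuous (rho kappa delta : R) (n : nat) (v : R * R) (p : R * R) :
  continuous (fun q : R * R => fst (cell_iter rho kappa (fst q + delta) (snd q) n v)) p /\
  continuous (fun q : R * R => snd (cell_iter rho kappa (fst q + delta) (snd q) n v)) p.
Proof.
  pose proof (continuous_cos_fst delta p) as Hcx.
  assert (Hsx : continuous (fun q : R * R => sin (fst q + delta)) p)
    by exact (continuous_comp _ sin p (continuous_shifted_fst delta p) (continuous_sin _)).
  assert (Hy : continuous (fun q : R * R => snd q) p)
    by (destruct p as [px py]; apply continuous_snd).
  assert (Hcy : continuous (fun q : R * R => cos (snd q)) p)
    by exact (continuous_comp (fun q : R * R => snd q) cos p Hy (continuous_cos _)).
  assert (Hsy : continuous (fun q : R * R => sin (snd q)) p)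
    by exact (continuous_comp (fun q : R * R => snd q) sin p Hy (continuous_sin _)).
  induction n as [|n [IH1 IH2]]; [split; apply continuous_const|].
  set (u q := fst (cell_iter rho kappa (fst q + delta) (snd q) n v)) in *.
  set (w q := snd (cell_iter rho kappa (fst q + delta) (snd q) n v)) in *.
  set (cx (q : R * R) := cos (fst q + delta)) in *.
  set (sx (q : R * R) := sin (fst q + delta)) in *.
  set (cy (q : R * R) := cos (snd q)) in *.
  set (sy (q : R * R) := sin (snd q)) in *.
  assert (Hu : continuous (fun q => rho * cx q * u q) p).
  { apply (continuous_Rmult (fun q => rho * cx q) u); [|exact IH1].
    apply (continuous_Rmult (fun _ => rho) cx); [apply continuous_const | exact Hcx]. }
  assert (Hw : continuous (fun q => / rho * cx q * w q - kappa * sx q * u q) p).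
  { apply (continuous_Rminus (fun q => / rho * cx q * w q) (fun q => kappa * sx q * u q)).
    - apply (continuous_Rmult (fun q => / rho * cx q) w); [|exact IH2].
      apply (continuous_Rmult (fun _ => / rho) cx); [apply continuous_const | exact Hcx].
    - apply (continuous_Rmult (fun q => kappa * sx q) u); [|exact IH1].
      apply (continuous_Rmult (fun _ => kappa) sx); [apply continuous_const | exact Hsx]. }
  split.
  - exact (continuous_Rplus _ _ p (continuous_Rmult _ cy p Hu Hcy)
             (continuous_Rmult _ sy p Hw Hsy)).
  - exact (continuous_Rminus _ _ p (continuous_Rmult _ cy p Hw Hcy)
             (continuous_Rmult _ sy p Hu Hsy)).
Qed.

Lemma profile_continuous (rho kappa delta : R) (N : nat) (p : R * R) :
  rho <> 0 -> kappa <> 0 -> (cos (fst p + delta) <> 0 \/ sin (snd p) <> 0) ->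
  continuous (fun q : R * R => profile rho kappa N (fst q + delta) (snd q)) p.
Proof.
  intros Hrho Hkappa Hp.
  pose proof (cell_den_pos rho kappa _ _ Hrho N Hkappa Hp) as Hpos.
  assert (Hden : continuous
            (fun q : R * R => cell_den rho kappa (fst q + delta) (snd q) N) p).
  { destruct (cell_iter_continuous rho kappa delta N (1, 0) p) as [Ha Hc].
    destruct (cell_iter_continuous rho kappa delta N (0, 1) p) as [Hb Hd].
    exact (continuous_Rplus _ _ p
             (continuous_Rpow _ 2 p (continuous_Rplus _ _ p Ha Hd))
             (continuous_Rpow _ 2 p (continuous_Rminus _ _ p Hc Hb))). }
  refine (continuous_Rmult (fun q => 4 * (cos (fst q + delta) ^ N) ^ 2)
            (fun q => / cell_den rho kappa (fst q + delta) (snd q) N) p _ _).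
  - exact (continuous_Rmult (fun _ => 4) _ p (continuous_const _ _)
             (continuous_Rpow _ 2 p (continuous_Rpow _ N p (continuous_cos_fst delta p)))).
  - refine (continuous_comp _ Rinv p Hden _).
    apply continuity_pt_filterlim, continuity_pt_inv; [|lra].
    apply derivable_continuous_pt, derivable_pt_id.
Qed.

(** * Scattering solutions and chains *)

(** The state of a resonator at its far end is a multiple of the cosine and sine
    of this angle: [(1, 0)] for Neumann, [(0, -1)] for Dirichlet. *)
Definition end_shift (alpha : R) : R := if Req_EM_T alpha 0 then 0 else - (PI / 2).

(** The two minus signs are those of the endpoint condition and of the direction
    of the derivative. *)
Lemma endpoint_amplitude (alpha beta k : R) (U W : C) :
  (alpha, beta) <> (0, 0) -> alpha = 0 \/ beta = 0 -> k <> 0 ->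
  (RtoC alpha * U + RtoC beta * (- - (RtoC k * W)) = 0)%C <->
  exists A, (U = A * RtoC (cos (end_shift alpha)) /\ W = A * RtoC (sin (end_shift alpha)))%C.
Proof.
  intros Hab H0 Hk; unfold end_shift; destruct (Req_EM_T alpha 0) as [Ha | Ha].
  - assert (Hb : RtoC beta <> RtoC 0) by (apply RtoC_neq0; congruence).
    apply RtoC_neq0 in Hk.
    rewrite Ha, cos_0, sin_0; split.
    + intros E; exists U; split; [ring|].
      apply (Cmult_cancel (RtoC beta)), (Cmult_cancel (RtoC k)); try assumption.
      transitivity (RtoC 0 * U + RtoC beta * (- - (RtoC k * W)))%C; [ring|]; rewrite E; ring.
    + intros [A [-> ->]]; ring.
  - assert (Hb : beta = 0) by tauto; apply RtoC_neq0 in Ha.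
    rewrite Hb, cos_neg, sin_neg, cos_PI2, sin_PI2, RtoC_opp; split.
    + intros E; exists (- W)%C; split; [|ring].
      apply (Cmult_cancel (RtoC alpha)); [assumption|].
      transitivity (RtoC alpha * U + RtoC 0 * (- - (RtoC k * W)))%C; [ring|]; rewrite E; ring.
    + intros [A [-> ->]]; ring.
Qed.

Lemma wave_lead_in (k : R) (r : C) (x : R) :
  wave k (lead_in r) x = (expi (k * x) + r * expi (- (k * x)))%C.
Proof.
  destruct r as [r1 r2]; unfold wave, lead_in, expi; rewrite cos_neg, sin_neg.
  apply C_ext; simpl; ring.
Qed.

Lemma wave_lead_out (k : R) (t : C) (x : R) :
  wave k (lead_out t) x = (t * expi (k * x))%C.
Proof.
  destruct t as [t1 t2]; unfold wave, lead_out, expi; apply C_ext; simpl; ring.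
Qed.

Lemma rot_lead_out (y : R) (t : C) : rot y (lead_out t) = lead_out (t * expi y)%C.
Proof.
  destruct t as [t1 t2]; unfold rot, lead_out, expi; apply injective_projections;
    apply C_ext; simpl; ring.
Qed.

Lemma rot_pure (a b : R) (A : C) :
  rot a ((A * RtoC (cos b))%C, (A * RtoC (sin b))%C) =
    ((A * RtoC (cos (b - a)))%C, (A * RtoC (sin (b - a)))%C).
Proof.
  unfold rot; simpl fst; simpl snd; rewrite cos_minus, sin_minus.
  rewrite RtoC_plus, RtoC_minus, !RtoC_mult; f_equal; ring.
Qed.

Lemma rot_rot (a b : R) (S : C * C) : rot a (rot b S) = rot (a + b) S.
Proof.
  unfold rot; simpl fst; simpl snd; rewrite cos_plus, sin_plus.
  rewrite RtoC_plus, RtoC_minus, !RtoC_mult; f_equal; ring.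
Qed.

Lemma rot_0 (S : C * C) : rot 0 S = S.
Proof.
  destruct S; unfold rot; simpl fst; simpl snd; rewrite cos_0, sin_0; f_equal; ring.
Qed.

Lemma wave_edge_right_at (k : R) (S : C * C) (x : R) (f : R -> C) (e : R) :
  0 < e -> (forall s, 0 < s < e -> f (x + s) = wave k S s) ->
  edge_data (fun s => f (x + s)) (fst S) (RtoC k * snd S).
Proof.
  intros He Hf; refine (edge_data_germ (wave k S) _ _ _ e He _ (wave_edge_right k S)).
  intros s Hs; symmetry; auto.
Qed.

Lemma wave_edge_left_at (k : R) (S : C * C) (x : R) (f : R -> C) (e : R) :
  0 < e -> (forall s, 0 < s < e -> f (x - s) = wave k S (- s)) ->
  edge_data (fun s => f (x - s)) (fst S) (- (RtoC k * snd S)).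
Proof.
  intros He Hf.
  refine (edge_data_germ (fun s => wave k S (- s)) _ _ _ e He _ (wave_edge_left k S)).
  intros s Hs; symmetry; auto.
Qed.

Lemma vertex_pos_S (h : R) (n : nat) : vertex_pos h (Datatypes.S n) = vertex_pos h n + h.
Proof. unfold vertex_pos; rewrite S_INR; ring. Qed.

Lemma vertex_pos_lt (h : R) (i j : nat) : 0 < h -> (i < j)%nat ->
  vertex_pos h i + h <= vertex_pos h j.
Proof.
  intros Hh Hij; rewrite <- vertex_pos_S; unfold vertex_pos.
  apply Rmult_le_compat_r; [lra | apply le_INR; lia].
Qed.

Lemma vertex_pos_ge0 (h : R) (n : nat) : 0 < h -> 0 <= vertex_pos h n.
Proof. intros Hh; apply Rmult_le_pos; [apply pos_INR | lra]. Qed.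

(** The state arriving at the [n]-th vertex is pinned down by the one-sided data of
    the channel function on its left; the equation on the next edge and on the
    resonator, solved explicitly, carries it to the next vertex.  After the last
    vertex a further piece of length [h] of the outgoing lead is treated as an
    edge, which only adds a phase to [t]. *)
Lemma scattering_chain (N : nat) (h l : R) (ty : vertex_type)
    (theta1 theta2 theta3 alpha beta k : R) (psi : graph_function) (r t : C) :
  (1 <= N)%nat -> 0 < h -> 0 < l -> 0 < k ->
  (alpha, beta) <> (0, 0) -> alpha = 0 \/ beta = 0 ->
  scattering_solution N h l ty theta1 theta2 theta3 alpha beta k psi r t ->
  chain (resonator_rel ty theta1 theta2 theta3 (k * l + end_shift alpha) k) (k * h) N
    (lead_in r) (lead_out (t * expi (k * vertex_pos h N))%C).
Proof.
  intros HN Hh Hl Hk Hab HND [[Hch Hres] [Hv [He [Hin Hout]]]].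
  assert (Hk0 : k <> 0) by lra.
  pose proof (RtoC_neq0 _ Hk0) as HkC.
  assert (Hcancel : forall a b : C, (RtoC k * a = RtoC k * b -> a = b)%C)
    by (intros a b; apply Cmult_cancel; assumption).
  assert (Inv : forall n, (n <= N)%nat -> exists S,
    chain (resonator_rel ty theta1 theta2 theta3 (k * l + end_shift alpha) k) (k * h) n
      (lead_in r) S /\
    edge_data (fun s => channel psi (vertex_pos h n - s)) (fst S) (- (RtoC k * snd S))).
  { induction n as [|n IH]; intros Hn.
    - exists (lead_in r); split; [reflexivity|].
      apply (wave_edge_left_at k _ _ (channel psi) 1); [lra|].
      intros s Hs; unfold vertex_pos; simpl INR; rewrite Rmult_0_l, Rminus_0_l.
      rewrite wave_lead_in; apply Hin; lra.
    - destruct IH as [S1 [Hchain Hleft]]; [lia|].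
      destruct (Hv n) as [p1 [p2 [p3 [d1 [d2 [d3 [E1 [E2 [E3 HV]]]]]]]]]; [lia|].
      destruct (He n) as [c [d [E4 HE]]]; [lia|].
      destruct (helmholtz_interval k (vertex_pos h n) (vertex_pos h n + h) (vertex_pos h n)
                  (channel psi) Hk0) as [S2 HS2]; [lra| |].
      { destruct Hch as [f1 Hf1]; exists f1; intros x Hx; apply Hf1.
        intros j Hj ->; destruct (Nat.lt_trichotomy j n) as [H | [-> | H]];
          [pose proof (vertex_pos_lt h j n Hh H); lra | lra |
           pose proof (vertex_pos_lt h n j Hh H); lra]. }
      destruct (helmholtz_interval k 0 l 0 (resonator psi n) Hk0 Hl (Hres n Hn)) as [S3 HS3].
      destruct (edge_data_unique _ _ _ _ _ E1 Hleft) as [-> ->].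
      assert (D2 := wave_edge_right_at k S2 (vertex_pos h n) (channel psi) h Hh).
      destruct (edge_data_unique _ _ _ _ _ E2 (D2 ltac:(intros s Hs; rewrite HS2 by lra;
        f_equal; ring))) as [-> ->].
      destruct (edge_data_unique _ _ _ _ _ E3
        (edge_data_germ (wave k S3) (resonator psi n) _ _ l Hl
          ltac:(intros s Hs; rewrite HS3 by lra; f_equal; ring) (wave_edge_right k S3)))
        as [-> ->].
      assert (D4 := wave_edge_left_at k (rot (k * l) S3) l (resonator psi n) l Hl).
      destruct (edge_data_unique _ _ _ _ _ E4 (D4 ltac:(intros s Hs; rewrite HS3 by lra;
        rewrite <- wave_shift; f_equal; ring))) as [-> ->].
      apply (endpoint_amplitude alpha beta k _ _ Hab HND Hk0) in HE.
      destruct HE as [A [HA1 HA2]].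
      assert (HS3' : S3 = ((A * RtoC (cos (k * l + end_shift alpha)))%C,
                           (A * RtoC (sin (k * l + end_shift alpha)))%C)).
      { rewrite <- (rot_0 S3).
        replace 0 with (- (k * l) + k * l) at 1 by ring.
        rewrite <- rot_rot, (surjective_pairing (rot (k * l) S3)), HA1, HA2, rot_pure.
        do 2 f_equal; f_equal; f_equal; ring. }
      exists (rot (k * h) S2); split.
      + exists S1, S2; split; [exact Hchain | split; [|reflexivity]].
        exists A; rewrite HS3' in HV; exact HV.
      + apply (wave_edge_left_at k _ _ (channel psi) h Hh).
        intros s Hs; rewrite vertex_pos_S, HS2, <- wave_shift by lra; f_equal; ring. }
  destruct (Inv N (le_n N)) as [S [Hchain Hleft]].
  assert (D := wave_edge_left_at k (lead_out (t * expi (k * vertex_pos h N))%C)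
                 (vertex_pos h N) (channel psi) h Hh).
  destruct (edge_data_unique _ _ _ _ _ Hleft (D ltac:(intros s Hs; rewrite Hout;
    [ rewrite <- rot_lead_out, <- wave_shift, wave_lead_out; reflexivity
    | replace N with (Datatypes.S (N - 1)) at 2 by lia; rewrite vertex_pos_S; lra])))
    as [F1 F2].
  rewrite (surjective_pairing S), F1 in Hchain.
  replace (snd S) with (snd (lead_out (t * expi (k * vertex_pos h N))%C)) in Hchain;
    [exact Hchain|].
  symmetry; apply Hcancel.
  transitivity (- - (RtoC k * snd S))%C; [ring|]; rewrite F2; ring.
Qed.

Lemma helmholtz_glue (E1 E2 : R -> Prop) (k c : R) (f g : R -> C) :
  helmholtz_on E1 k f -> helmholtz_on E2 k g ->
  helmholtz_on (fun x => (x < c /\ E1 x) \/ (c < x /\ E2 x)) k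
    (fun x => if Rlt_dec x c then f x else g x).
Proof.
  intros [f1 Hf] [g1 Hg].
  assert (Hleft : forall (u v : R -> C) x, x < c ->
    locally x (fun y => u y = if Rlt_dec y c then u y else v y)).
  { intros u v x Hx; generalize (open_lt c x Hx); apply filter_imp; intros y Hy.
    destruct (Rlt_dec y c); [reflexivity | contradiction]. }
  assert (Hright : forall (u v : R -> C) x, c < x ->
    locally x (fun y => v y = if Rlt_dec y c then u y else v y)).
  { intros u v x Hx; generalize (open_gt c x Hx); apply filter_imp; intros y Hy.
    destruct (Rlt_dec y c); [lra | reflexivity]. }
  exists (fun x => if Rlt_dec x c then f1 x else g1 x); intros x [[Hx Ex] | [Hx Ex]];
    destruct (Rlt_dec x c); try lra.
  - destruct (Hf x Ex) as [H1 H2]; split;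
      [exact (is_derive_ext_loc _ _ _ _ (Hleft f g x Hx) H1)
      |exact (is_derive_ext_loc _ _ _ _ (Hleft f1 g1 x Hx) H2)].
  - destruct (Hg x Ex) as [H1 H2]; split;
      [exact (is_derive_ext_loc _ _ _ _ (Hright f g x Hx) H1)
      |exact (is_derive_ext_loc _ _ _ _ (Hright f1 g1 x Hx) H2)].
Qed.

Lemma helmholtz_subset (E E' : R -> Prop) (k : R) (f : R -> C) :
  (forall x, E' x -> E x) -> helmholtz_on E k f -> helmholtz_on E' k f.
Proof. intros HE [f1 Hf]; exists f1; intros x Hx; apply Hf, HE, Hx. Qed.

(** The converse construction, by attaching one vertex at a time: the rightmost
    wave is cut at the new vertex and continued by the next one.  For [n = 0] the
    channel is the whole line and carries a single wave. *)
Lemma chain_graph_function (h l : R) (ty : vertex_type)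
    (theta1 theta2 theta3 alpha beta k : R) (n : nat) (S0 S : C * C) :
  0 < h -> 0 < l -> 0 < k -> (alpha, beta) <> (0, 0) -> alpha = 0 \/ beta = 0 ->
  chain (resonator_rel ty theta1 theta2 theta3 (k * l + end_shift alpha) k) (k * h) n S0 S ->
  exists psi,
    satisfies_equation n h l k psi /\
    satisfies_vertex_conditions n h ty theta1 theta2 theta3 psi /\
    satisfies_endpoint_conditions n l alpha beta psi /\
    (forall x, x < 0 -> channel psi x = wave k S0 x) /\
    (forall x, (forall j, (j < n)%nat -> vertex_pos h j < x) ->
       channel psi x = wave k S (x - vertex_pos h n)).
Proof.
  intros Hh Hl Hk Hab HND; assert (Hk0 : k <> 0) by lra.
  revert S; induction n as [|n IH]; intros S; simpl chain.
  - intros ->; exists (GraphFunction (wave k S0) (fun _ _ => RtoC 0)); simpl.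
    unfold satisfies_equation, satisfies_vertex_conditions, satisfies_endpoint_conditions.
    split; [split; [|intros j Hj; lia]|].
    + destruct (wave_helmholtz (channel_interior 0 h) k 0 S0) as [f1 Hf1].
      exists f1; intros x Hx; destruct (Hf1 x Hx) as [H1 H2]; rewrite Rminus_0_r in H2.
      split; [|exact H2].
      refine (is_derive_ext _ _ _ _ _ H1); intros y; simpl; rewrite Rminus_0_r; reflexivity.
    + split; [intros j Hj; lia | split; [intros j Hj; lia|]].
      split; [reflexivity|].
      intros x _; f_equal; unfold vertex_pos; simpl; ring.
  - intros [S1 [S2 [Hchain [[A HV] ->]]]].
    destruct (IH S1 Hchain) as [psi [[Hch Hres] [Hv [He [Hin Hout]]]]].
    set (phi := k * l + end_shift alpha) in *.
    set (S3 := ((A * RtoC (cos phi))%C, (A * RtoC (sin phi))%C)).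
    set (c := vertex_pos h n).
    assert (Hres_old : forall j, (j < n)%nat ->
      (if Nat.eq_dec j n then wave k S3 else resonator psi j) = resonator psi j)
      by (intros j Hj; destruct (Nat.eq_dec j n); [lia | reflexivity]).
    assert (Hres_new : forall j, j = n ->
      (if Nat.eq_dec j n then wave k S3 else resonator psi j) = wave k S3)
      by (intros j Hj; destruct (Nat.eq_dec j n); [reflexivity | lia]).
    assert (Hch_left : forall x, x < c ->
      (if Rlt_dec x c then channel psi x else wave k S2 (x - c)) = channel psi x)
      by (intros x Hx; destruct (Rlt_dec x c); [reflexivity | lra]).
    assert (Hch_right : forall x, c < x ->
      (if Rlt_dec x c then channel psi x else wave k S2 (x - c)) = wave k S2 (x - c))
      by (intros x Hx; destruct (Rlt_dec x c); [lra | reflexivity]).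
    exists (GraphFunction
              (fun x => if Rlt_dec x c then channel psi x else wave k S2 (x - c))
              (fun j => if Nat.eq_dec j n then wave k S3 else resonator psi j)).
    split; [split|split; [|split; [|split]]].
    + refine (helmholtz_subset _ _ k _ _
        (helmholtz_glue _ (fun _ => True) k c _ _ Hch (wave_helmholtz _ k c S2))).
      intros x Hx; destruct (Rtotal_order x c) as [H | [H | H]].
      * left; split; [exact H | intros j Hj; apply Hx; lia].
      * exfalso; apply (Hx n); [lia | exact H].
      * right; auto.
    + intros j Hj; simpl; destruct (Nat.eq_dec j n) as [E | E]; [|apply Hres; lia].
      destruct (wave_helmholtz (fun s => 0 < s < l) k 0 S3) as [f1 Hf1].
      exists f1; intros x Hx; destruct (Hf1 x Hx) as [H1 H2]; rewrite Rminus_0_r in H2.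
      split; [|exact H2].
      refine (is_derive_ext _ _ _ _ _ H1); intros y; simpl; rewrite Rminus_0_r; reflexivity.
    + intros j Hj; simpl; destruct (Nat.eq_dec j n) as [-> | E].
      * exists (fst S1), (fst S2), (fst S3), (- (RtoC k * snd S1))%C, (RtoC k * snd S2)%C,
          (RtoC k * snd S3)%C.
        split; [|split; [|split; [apply wave_edge_right | exact HV]]].
        -- apply (wave_edge_left_at k S1 c
             (fun x => if Rlt_dec x c then channel psi x else wave k S2 (x - c)) h Hh).
           intros s Hs; rewrite Hch_left, Hout by
             (lra || (intros i Hi; pose proof (vertex_pos_lt h i n Hh Hi); unfold c; lra)).
           f_equal; unfold c; ring.
        -- apply (wave_edge_right_at k S2 c
             (fun x => if Rlt_dec x c then channel psi x else wave k S2 (x - c)) h Hh).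
           intros s Hs; rewrite Hch_right by lra; f_equal; ring.
      * assert (Hjn : (j < n)%nat) by lia.
        pose proof (vertex_pos_lt h j n Hh Hjn) as Hpos.
        destruct (Hv j Hjn) as [p1 [p2 [p3 [d1 [d2 [d3 [E1 [E2 [E3 HV']]]]]]]]].
        exists p1, p2, p3, d1, d2, d3; split; [|split; [|split; assumption]].
        -- refine (edge_data_germ _ _ _ _ h Hh _ E1); intros s Hs; symmetry.
           apply Hch_left; unfold c; lra.
        -- refine (edge_data_germ _ _ _ _ h Hh _ E2); intros s Hs; symmetry.
           apply Hch_left; unfold c; lra.
    + intros j Hj; simpl; destruct (Nat.eq_dec j n) as [-> | E]; [|apply He; lia].
      exists (fst (rot (k * l) S3)), (- (RtoC k * snd (rot (k * l) S3)))%C; split.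
      * apply (wave_edge_left_at k _ l (wave k S3) l Hl); intros s _.
        rewrite <- wave_shift; f_equal; ring.
      * apply (endpoint_amplitude alpha beta k _ _ Hab HND Hk0); exists A.
        unfold S3; rewrite rot_pure; simpl fst; simpl snd.
        replace (phi - k * l) with (end_shift alpha) by (unfold phi; ring); auto.
    + intros x Hx; simpl; pose proof (vertex_pos_ge0 h n Hh).
      rewrite Hch_left by (unfold c; lra); auto.
    + intros x Hx; simpl; rewrite Hch_right by (apply Hx; lia).
      rewrite vertex_pos_S, <- wave_shift; f_equal; unfold c; ring.
Qed.

Lemma Cmod_expi (y : R) : Cmod (expi y) = 1.
Proof.
  pose proof (sin2_cos2 y) as E; unfold Rsqr in E.
  rewrite <- sqrt_1; unfold Cmod, expi; simpl fst; simpl snd; f_equal; rewrite <- E; ring.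
Qed.

Lemma chain_scattering (N : nat) (h l : R) (ty : vertex_type)
    (theta1 theta2 theta3 alpha beta k : R) (r t : C) :
  (1 <= N)%nat -> 0 < h -> 0 < l -> 0 < k ->
  (alpha, beta) <> (0, 0) -> alpha = 0 \/ beta = 0 ->
  chain (resonator_rel ty theta1 theta2 theta3 (k * l + end_shift alpha) k) (k * h) N
    (lead_in r) (lead_out t) ->
  exists psi, scattering_solution N h l ty theta1 theta2 theta3 alpha beta k psi
    r (t * expi (- (k * vertex_pos h N)))%C.
Proof.
  intros HN Hh Hl Hk Hab HND Hchain.
  destruct (chain_graph_function _ _ _ _ _ _ _ _ _ _ _ _ Hh Hl Hk Hab HND Hchain)
    as [psi [H1 [H2 [H3 [Hin Hout]]]]].
  exists psi; repeat (split; [assumption|]); split.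
  - intros x Hx; rewrite Hin by exact Hx; apply wave_lead_in.
  - intros x Hx; rewrite Hout.
    + rewrite <- wave_lead_out, <- rot_lead_out.
      replace (- (k * vertex_pos h N)) with (k * - vertex_pos h N) by ring.
      rewrite <- wave_shift; f_equal; ring.
    + intros j Hj; apply Rle_lt_trans with (2 := Hx); unfold vertex_pos.
      apply Rmult_le_compat_r; [lra | apply le_INR; lia].
Qed.

(** Since solutions exist, the amplitudes chosen by description belong to one of
    them; its transmission is then forced. *)
Lemma transmission_profile (N : nat) (h l : R) (ty : vertex_type)
    (theta1 theta2 theta3 alpha beta k : R) :
  (1 <= N)%nat -> 0 < h -> 0 < l -> theta1 <> 0 -> theta2 <> 0 -> theta3 <> 0 ->
  (alpha, beta) <> (0, 0) -> alpha = 0 \/ beta = 0 -> 0 < k ->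
  transmission N h l ty theta1 theta2 theta3 alpha beta k =
    profile (turned_theta ty theta2 / theta1)
      (theta3 ^ 2 / (theta1 * turned_theta ty theta2)) N
      (k * l + (end_shift alpha + turn_shift ty)) (k * h).
Proof.
  intros HN Hh Hl H1 H2 H3 Hab HND Hk.
  assert (Hk0 : k <> 0) by lra.
  assert (Hsigma : turned_theta ty theta2 <> 0) by (destruct ty; simpl; lra).
  pose proof (fun S S' => resonator_rel_turn ty theta1 theta2 theta3
                (k * l + end_shift alpha) k S S' H1 H2 H3 Hk0) as Hturn.
  rewrite Rplus_assoc in Hturn.
  set (x := k * l + (end_shift alpha + turn_shift ty)) in *.
  unfold transmission, amplitudes.
  match goal with |- context [epsilon ?i ?P] =>
    pose proof (epsilon_spec i P) as Hspec; set (rt := epsilon i P) in * end.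
  destruct Hspec as [psi Hpsi].
  - destruct (chain_amplitudes theta1 (turned_theta ty theta2) theta3 x (k * h) N
                H1 Hsigma H3 HN) as [r [t Hchain]].
    apply (chain_turn _ (resonator_rel ty theta1 theta2 theta3 (k * l + end_shift alpha) k) ty)
      in Hchain.
    + rewrite <- (turn_lead_in ty r), <- (turn_lead_out ty t), !turn_turn in Hchain.
      apply (chain_scattering N h l ty theta1 theta2 theta3 alpha beta k _ _ HN Hh Hl Hk Hab HND)
        in Hchain.
      destruct Hchain as [psi Hpsi]; eexists (_, _); exists psi; exact Hpsi.
    + intros S S' HV; apply Hturn; rewrite !turn_turn; exact HV.
  - apply (scattering_chain _ _ _ _ _ _ _ _ _ _ _ _ _ HN Hh Hl Hk Hab HND) in Hpsi.
    apply (chain_turn _ (vertex_rel theta1 (turned_theta ty theta2) theta3 x) ty) in Hpsi;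
      [|intros S S'; apply Hturn].
    rewrite turn_lead_out in Hpsi.
    assert (Hin : exists r', turn ty (lead_in (fst rt)) = lead_in r').
    { exists (match ty with TypeI => fst rt | TypeII => - fst rt end)%C.
      rewrite <- (turn_lead_in ty (fst rt)), turn_turn; reflexivity. }
    destruct Hin as [r' Hr']; rewrite Hr' in Hpsi.
    apply chain_transmission in Hpsi; try assumption.
    rewrite <- Hpsi, Cmod_mult, Cmod_expi, Rmult_1_r; reflexivity.
Qed.

(** * Periodicity and quasi-periodicity of the transmission *)

(** The phases at which a wave can be confined between two consecutive blocking
    resonators. *)
Definition trapped (delta : R) (p : R * R) : Prop :=
  cos (fst p + delta) = 0 /\ sin (snd p) = 0.

Lemma sin_zero_small (z : R) : Rabs z < 1 -> sin z = 0 -> z = 0.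
Proof.
  intros Hz Hs; apply Rabs_def2 in Hz; pose proof PI2_1.
  destruct (Rtotal_order z 0) as [H0 | [H0 | H0]]; [|exact H0|].
  - pose proof (sin_gt_0 (- z)) as Hp; rewrite sin_neg in Hp; lra.
  - pose proof (sin_gt_0 z) as Hp; lra.
Qed.

Lemma trapped_closed_discrete (delta : R) : closed_discrete (trapped delta).
Proof.
  split.
  - apply closed_and.
    + apply (closed_comp (fun q : R * R => cos (fst q + delta)) (fun z => z = 0));
        [|apply closed_eq].
      intros q; apply continuous_cos_fst.
    + apply (closed_comp (fun q : R * R => sin (snd q)) (fun z => z = 0)); [|apply closed_eq].
      intros [px py]; exact (continuous_comp (fun q : R * R => snd q) sin _
                                 (continuous_snd _ _) (continuous_sin _)).
  - intros [px py] [Hc Hs]; exists (mkposreal 1 Rlt_0_1).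
    intros [qx qy] [Bx By] [Hc' Hs']; simpl in *.
    change (Rabs (qx - px) < 1) in Bx; change (Rabs (qy - py) < 1) in By.
    apply sin_zero_small in By.
    + apply sin_zero_small in Bx; [f_equal; lra|].
      replace (qx - px) with ((qx + delta) - (px + delta)) by ring.
      rewrite sin_minus, Hc, Hc'; ring.
    + rewrite sin_minus, Hs, Hs'; ring.
Qed.

(** As [2 delta] is a multiple of [PI], both [2 k l] and [k h] would be multiples
    of [PI]. *)
Lemma trapped_rational (delta l h k : R) :
  0 < k -> 0 < h -> sin (2 * delta) = 0 -> trapped delta (k * l, k * h) -> rational (l / h).
Proof.
  intros Hk Hh Hdelta [Hc Hs]; simpl in *.
  assert (H2 : sin (2 * (k * l)) = 0).
  { replace (2 * (k * l)) with (2 * (k * l + delta) - 2 * delta) by ring.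
    rewrite sin_minus, (sin_2a (k * l + delta)), Hc, Hdelta; ring. }
  apply sin_eq_0_0 in H2; apply sin_eq_0_0 in Hs.
  destruct H2 as [m Hm]; destruct Hs as [n Hn].
  pose proof PI_RGT_0.
  assert (Hn0 : (0 < n)%Z).
  { apply lt_IZR, Rmult_lt_reg_r with PI; [assumption|].
    rewrite <- Hn, Rmult_0_l; apply Rmult_lt_0_compat; assumption. }
  exists (m # Z.to_pos (2 * n))%Q; unfold Q2R, Qnum, Qden.
  rewrite Z2Pos.id, mult_IZR by lia.
  assert (Hn' : 0 < IZR n) by (apply (IZR_lt 0); exact Hn0).
  replace (l / h) with (2 * (k * l) / (2 * (k * h))) by (field; lra).
  rewrite Hm, Hn; field; lra.
Qed.

Lemma iterate_period (f : R -> R) (P : R) (n : nat) :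
  (forall x, f (x + P) = f x) -> forall x, f (x + INR n * P) = f x.
Proof.
  intros Hf; induction n as [|n IH]; intros x; [simpl; f_equal; ring|].
  rewrite S_INR; replace (x + (INR n + 1) * P) with (x + INR n * P + P) by ring.
  rewrite Hf; apply IH.
Qed.

Lemma shift_double (alpha : R) (ty : vertex_type) :
  sin (2 * (end_shift alpha + turn_shift ty)) = 0.
Proof.
  unfold end_shift; destruct (Req_EM_T alpha 0), ty; simpl turn_shift.
  - rewrite Rplus_0_r, Rmult_0_r; apply sin_0.
  - replace (2 * (0 + PI / 2)) with PI by field; apply sin_PI.
  - replace (2 * (- (PI / 2) + 0)) with (- PI) by field; rewrite sin_neg, sin_PI; ring.
  - replace (2 * (- (PI / 2) + PI / 2)) with 0 by field; apply sin_0.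
Qed.

Theorem mainTheorem4 (N : nat) (h l theta1 theta2 theta3 alpha beta : R)
    (ty : vertex_type)
    (hN : (1 <= N)%nat) (hh : 0 < h) (hl : 0 < l)
    (htheta : theta1 * theta2 * theta3 <> 0)
    (hab : (alpha, beta) <> (0, 0))
    (hND : alpha = 0 \/ beta = 0) :
  (rational (l / h) ->
     periodic_pos (transmission N h l ty theta1 theta2 theta3 alpha beta)) /\
  (~ rational (l / h) ->
     two_frequency_quasi_periodic l h
       (transmission N h l ty theta1 theta2 theta3 alpha beta)).
Proof.
  assert (H1 : theta1 <> 0) by (intros E; apply htheta; rewrite E; ring).
  assert (H2 : theta2 <> 0) by (intros E; apply htheta; rewrite E; ring).
  assert (H3 : theta3 <> 0) by (intros E; apply htheta; rewrite E; ring).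
  pose proof (transmission_profile N h l ty theta1 theta2 theta3 alpha beta) as HT.
  set (rho := turned_theta ty theta2 / theta1) in *.
  set (kappa := theta3 ^ 2 / (theta1 * turned_theta ty theta2)) in *.
  set (delta := end_shift alpha + turn_shift ty) in *.
  split.
  - intros [[a b] Hq]; unfold Q2R in Hq; simpl in Hq.
    pose proof PI_RGT_0 as Hpi.
    assert (Hb : 0 < IZR (Zpos b)) by (apply (IZR_lt 0); reflexivity).
    assert (Hlab : l = IZR a * h / IZR (Zpos b)).
    { replace l with (l / h * h) by (field; lra); rewrite Hq; field; lra. }
    assert (Ha : 0 < IZR a).
    { apply Rmult_lt_reg_r with (h / IZR (Zpos b)); [apply Rdiv_lt_0_compat; lra|].
      rewrite Rmult_0_l; unfold Rdiv; rewrite <- Rmult_assoc; fold (IZR a * h / IZR (Zpos b)).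
      rewrite <- Hlab; exact hl. }
    (* with [l / h = a / b], this shift of [k] adds [a PI] to [k l] and [b PI] to [k h] *)
    exists (IZR (Zpos b) * PI / h); split.
    { apply Rdiv_lt_0_compat; [apply Rmult_lt_0_compat|]; assumption. }
    assert (HP : 0 < IZR (Zpos b) * PI / h)
      by (apply Rdiv_lt_0_compat; [apply Rmult_lt_0_compat|]; assumption).
    intros k Hk; rewrite !HT by (try assumption; lra).
    assert (Ea : IZR a = INR (Z.to_nat a)).
    { rewrite INR_IZR_INZ, Z2Nat.id; [reflexivity | apply le_IZR; lra]. }
    assert (Eb : IZR (Zpos b) = INR (Pos.to_nat b)).
    { rewrite INR_IZR_INZ, positive_nat_Z; reflexivity. }
    replace ((k + IZR (Zpos b) * PI / h) * l + delta) with (k * l + delta + IZR a * PI)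
      by (rewrite Hlab; field; lra).
    replace ((k + IZR (Zpos b) * PI / h) * h) with (k * h + IZR (Zpos b) * PI)
      by (field; lra).
    rewrite Ea, Eb.
    rewrite (iterate_period (fun x => profile rho kappa N x _) PI)
      by (intros x; apply profile_period_x).
    rewrite (iterate_period (fun y => profile rho kappa N _ y) PI)
      by (intros y; apply profile_period_y).
    reflexivity.
  - intros Hirr.
    destruct (cell_parameters_nonzero theta1 (turned_theta ty theta2) theta3 H1
                ltac:(destruct ty; simpl; lra) H3) as [Hrho Hkappa].
    fold rho in Hrho; fold kappa in Hkappa.
    exists (trapped delta), (fun p => profile rho kappa N (fst p + delta) (snd p)).
    split; [apply trapped_closed_discrete|].
    split; [intros x y; unfold trapped; simpl;
      replace (x + PI + delta) with (x + delta + PI) by ring; rewrite neg_cos;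
      split; intros [Hc Hs]; split; lra|].
    split; [intros x y; unfold trapped; simpl; rewrite neg_sin;
      split; intros [Hc Hs]; split; lra|].
    split.
    { intros p Hp; apply profile_continuous; try assumption.
      destruct (Req_dec (cos (fst p + delta)) 0) as [Hc | Hc]; [right | left; exact Hc].
      intros Hs; apply Hp; split; assumption. }
    split; [intros x y _; simpl;
      replace (x + PI + delta) with (x + delta + PI) by ring; apply profile_period_x|].
    split; [intros x y _; apply profile_period_y|].
    intros k Hk; split; [|apply HT; assumption].
    intros HD; apply Hirr.
    exact (trapped_rational delta l h k Hk hh (shift_double alpha ty) HD).
Qed.
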